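(* Let $1\le k<n$ be integers and let $\hat\partial_{n-1}$ act on $\mathrm{SSYT}(2^k,n-1)$ by $k$-promotion, so that $\hat\partial_{n-1}$ has order $n-1$ (i.e. it generates an action of the cyclic group of order $n-1$). Then $$\bigl(\mathrm{SSYT}(2^k,n-1),\ \langle\hat\partial_{n-1}\rangle,\ \mathbf{Nar}(n,k+1;q)\bigr)$$ exhibits the cyclic sieving phenomenon. Moreover, there is a cyclic group $\langle\varphi\rangle$ of order $n$ acting on $\mathrm{SSYT}(2^k,n-1)$ such that $$\bigl(\mathrm{SSYT}(2^k,n-1),\ \langle\varphi\rangle,\ \mathbf{Nar}(n,k+1;q)\bigr)$$ exhibits the cyclic sieving phenomenon.
   Context: Cyclic sieving: let $X$ be a finite set, $C_N$ a cyclic group of order $N$ with generator $g$ acting on $X$, and $f(q)$ a polynomial with non-negative integer coefficients. The triple $(X,C_N,f(q))$ exhibits the cyclic sieving phenomenon if for all $d\in\mathbb Z$, $|\{x\in X: g^d\cdot x=x\}|=f(\xi^d)$, where $\xi$ is a primitive $N$-th complex root of unity. $[m]_q=1+q+\dots+q^{m-1}$; $\begin{bmatrix} m\\ r\end{bmatrix}_q$ is the Gaussian $q$-binomial coefficient, equal to $0$ unless $m\ge r\ge 0$; $\mathbf{Nar}(n,k;q)=\frac{q^{k(k-1)}}{[n]_q}\begin{bmatrix} n\\ k\end{bmatrix}_q\begin{bmatrix} n\\ k-1\end{bmatrix}_q$. $\mathrm{SSYT}(\lambda,m)$ is the set of semistandard Young tableaux of shape $\lambda$ (rows weakly increasing,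 columns strictly increasing) with entries in $\{1,\dots,m\}$; $2^k$ is the partition with $k$ parts equal to $2$. $k$-promotion $\hat\partial_m$ on $\mathrm{SSYT}(\lambda,m)$ is promotion of semistandard tableaux with entries in $\{1,\dots,m\}$, i.e. $\hat\partial_m=t_1\circ t_2\circ\cdots\circ t_{m-1}$ ($t_{m-1}$ is applied first), where $t_i$ is the $i$-th Bender–Knuth involution: call an entry $i$ free if there is no $i+1$ directly below it in its column, and an entry $i+1$ free if there is no $i$ directly above it; in each row, if the free entries equal to $i$ or $i+1$ consist of $a$ copies of $i$ followed by $b$ copies of $i+1$, replace them by $b$ copies of $i$ followed by $a$ copies of $i+1$. (Equivalently: delete all entries $m$, slide the remaining entries by jeu de taquin, fill the vacated boxes with $0$, and add $1$ to every entry.) *)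

(* Defs.v *)
From mathcomp Require Import all_boot all_order all_algebra all_fingroup.
From mathcomp Require Import ring.

Set Implicit Arguments.
Unset Strict Implicit.
Unset Printing Implicit Defensive.

Import Order.TTheory GRing.Theory Num.Theory.
Local Open Scope ring_scope.

(* All divisors below are monic, so [%/] is Euclidean division in {poly int};
   it is moreover exact, see [qbinomK] and [qNarayanaK]. *)

Definition qint (m : nat) : {poly int} := \sum_(i < m) 'X^i.

Definition qfact (m : nat) : {poly int} := \prod_(i < m) qint i.+1.

Definition qbinom (m r : nat) : {poly int} :=
  if (r <= m)%N then qfact m %/ (qfact r * qfact (m - r)) else 0.

(* For k = 0 the lower index k - 1 of the second q-binomial is negative, so the
   value is 0. *)
Definition qNarayana (n k : nat) : {poly int} :=
  if k is j.+1 then ('X^(k * j) * qbinom n k * qbinom n j) %/ qint n else 0.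

Lemma qintS m : qint m.+1 = qint m + 'X^m.
Proof. by rewrite /qint big_ord_recr. Qed.

Lemma qint1 : qint 1 = 1.
Proof. by rewrite /qint big_ord1. Qed.

Lemma qintD a b : qint (a + b) = qint a + 'X^a * qint b.
Proof.
elim: b => [|b IHb]; first by rewrite addn0 {3}/qint big_ord0 mulr0 addr0.
by rewrite addnS !qintS IHb mulrDr -exprD addrA.
Qed.

Lemma qfact0 : qfact 0 = 1.
Proof. by rewrite /qfact big_ord0. Qed.

Lemma qfactS m : qfact m.+1 = qfact m * qint m.+1.
Proof. by rewrite /qfact big_ord_recr. Qed.

Lemma qint_monic m : qint m.+1 \is monic.
Proof.
have szle : (size (qint m) <= m)%N.
  apply: (leq_trans (size_sum _ _ _)); apply/bigmax_leqP => i _.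
  by rewrite size_polyXn.
by rewrite monicE qintS addrC lead_coefDl ?lead_coefXn // size_polyXn ltnS.
Qed.

Lemma qfact_monic m : qfact m \is monic.
Proof. by apply: monic_prod => i _; apply: qint_monic. Qed.

Lemma divp_monicK (p d : {poly int}) : d \is monic -> (p * d) %/ d = p.
Proof.
by move=> /monicP d1; apply: Pdiv.IdomainUnit.mulpK; rewrite d1 unitr1.
Qed.

Lemma qbinom_subproof a b :
  exists p : {poly int}, p * (qfact a * qfact b) = qfact (a + b).
Proof.
move Dn: (a + b)%N => n; elim: n a b Dn => [|n IHn] [|a] [|b] //= Dn.
- by exists 1; rewrite qfact0 !mul1r.
- by exists 1; rewrite -Dn add0n qfact0 !mul1r.
- by exists 1; rewrite -Dn addn0 qfact0 mulr1 mul1r.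
have Dn1 : (a + b.+1 = n)%N by case: Dn.
have Dn2 : (a.+1 + b = n)%N by rewrite addSnnS.
have [p1 Hp1] := IHn _ _ Dn1; have [p2 Hp2] := IHn _ _ Dn2.
exists (p1 + 'X^(a.+1) * p2); rewrite (qfactS n) -Dn qintD mulrDr.
by rewrite -{1}Hp1 -Hp2 (qfactS a) (qfactS b); ring.
Qed.

Fact qbinomK m r :
  (r <= m)%N -> qbinom m r * (qfact r * qfact (m - r)) = qfact m.
Proof.
move=> le_rm; have [p] := qbinom_subproof r (m - r); rewrite subnKC // => Dp.
by rewrite /qbinom le_rm -Dp divp_monicK // monicMl qfact_monic.
Qed.

Lemma qint_qbinom_sym m r :
  (r <= m)%N -> exists p : {poly int}, qint m.+1 * p = qint r.+1 * qbinom m.+1 r.+1.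
Proof.
move=> le_rm; exists (qbinom m r).
have reg : qfact r * qfact (m - r) != 0.
  by rewrite monic_neq0 // monicMl qfact_monic.
apply: (mulIf reg); rewrite -mulrA qbinomK // mulrC -qfactS.
by rewrite -(qbinomK (m := m.+1) (r := r.+1)) // subSS qfactS; ring.
Qed.

Fact qNarayanaK n k : (0 < k)%N -> (0 < n)%N ->
  qNarayana n k * qint n = 'X^(k * k.-1) * qbinom n k * qbinom n k.-1.
Proof.
case: k n => [|j] [|m] // _ _ /=; set A := _ * qbinom _ j.
suff [p Dp] : exists p : {poly int}, p * qint m.+1 = A.
  by rewrite -Dp divp_monicK // qint_monic.
have [lt_mj | le_jm] := ltnP m j.
  by exists 0; rewrite /A {1}/qbinom ltnS leqNgt lt_mj mulr0 !mul0r.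
have [p1 Dp1] := qint_qbinom_sym le_jm.
have [p2 Dp2] : exists p : {poly int},
    qint m.+1 * p = qint (m.+1 - j) * qbinom m.+1 j.
  have [p] := qint_qbinom_sym (leq_subr j m); rewrite -subSn // => Dp.
  exists p; rewrite Dp; congr (_ * _).
  by rewrite /qbinom leq_subr (leqW le_jm) subKn 1?leqW // [qfact j * _]mulrC.
pose s := 'X^(j.+1 * j) : {poly int}.
exists (s * p1 * qbinom m.+1 j + 'X^(j.+1) * s * qbinom m.+1 j.+1 * p2 - 'X * A).
have Deq : qint j.+1 + 'X^(j.+1) * qint (m.+1 - j) = 1 + 'X * qint m.+1.
  rewrite -qintD addSn subnKC 1?leqW // -(add1n m.+1) qintD qint1.
  by rewrite expr1.
rewrite mulrBl mulrDl.
have -> : s * p1 * qbinom m.+1 j * qint m.+1 = qint j.+1 * A.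
  by rewrite /A -/s; transitivity (s * (qint m.+1 * p1) * qbinom m.+1 j); [|rewrite Dp1]; ring.
have -> : 'X^(j.+1) * s * qbinom m.+1 j.+1 * p2 * qint m.+1
    = 'X^(j.+1) * qint (m.+1 - j) * A.
  rewrite /A -/s.
  transitivity ('X^(j.+1) * s * qbinom m.+1 j.+1 * (qint m.+1 * p2)); first ring.
  by rewrite Dp2; ring.
by rewrite -mulrDl Deq; ring.
Qed.

(* Boxes (row, column) of the diagram of [lam], both indexed from 0. *)
Definition box (lam : seq nat) : finType :=
  {i : 'I_(size lam) & 'I_(nth 0%N lam i)}.
Definition brow lam (b : box lam) : nat := tag b.
Definition bcol lam (b : box lam) : nat := tagged b.

(* The codomain 'I_m.+1 = {0, ..., m} is only a finite container: [is_ssyt]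
   excludes the value 0, so that entries lie in {1, ..., m}. *)
Definition is_ssyt lam m (T : {ffun box lam -> 'I_m.+1}) : bool :=
  [&& [forall b, 0 < T b]%N,
      [forall b, forall c,
         (brow b == brow c) && (bcol b < bcol c) ==> (T b <= T c)]%N
    & [forall b, forall c,
         (bcol b == bcol c) && (brow b < brow c) ==> (T b < T c)]%N].

Definition SSYT lam m : finType :=
  {T : {ffun box lam -> 'I_m.+1} | is_ssyt T}.

Definition entry lam m (T : SSYT lam m) (b : box lam) : nat := val T b.

Section BenderKnuth.

Variables (lam : seq nat) (i : nat) (T : box lam -> nat).

Definition free_lo (b : box lam) : bool :=
  (T b == i) &&
  ~~ [exists c, [&& bcol c == bcol b, brow c == (brow b).+1 & T c == i.+1]].

Definition free_hi (b : box lam) : bool :=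
  (T b == i.+1) &&
  ~~ [exists c, [&& bcol c == bcol b, brow b == (brow c).+1 & T c == i]].

Definition free (b : box lam) : bool := free_lo b || free_hi b.

(* The free boxes of a row are refilled from left to right by as many i's as
   there were free (i+1)'s in that row, followed by (i+1)'s. *)
Definition bender_knuth (b : box lam) : nat :=
  if free b then
    if (#|[set c | [&& brow c == brow b, (bcol c < bcol b)%N & free c]]|
        < #|[set c | (brow c == brow b) && free_hi c]|)%N
    then i else i.+1
  else T b.

End BenderKnuth.

(* t_1 (t_2 (... (t_(m-1) T))) *)
Definition promotion lam (m : nat) (T : box lam -> nat) : box lam -> nat :=
  foldr (fun i U => bender_knuth i U) T (iota 1 m.-1).

Definition expgz (gT : finGroupType) (g : gT) (d : int) : gT :=
  match d with
  | Posz e => (g ^+ e)%g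
  | Negz e => (g ^- e.+1)%g
  end.

(* The cyclic group is <[g]>, of order N = #[g]; its action need not be
   faithful. [C] stands for the complex numbers; algC and R[i] are instances. *)
Definition cyclic_sieving (C : numClosedFieldType) (gT : finGroupType) (g : gT)
    (X : finType) (to : action <[g]>%g X) (f : {poly int}) : Prop :=
  (forall j, 0 <= f`_j) /\
  (forall xi : C, #[g]%g.-primitive_root xi -> forall d : int,
     #|[set x | to x (expgz g d) == x]|%:R = (map_poly intr f).[xi ^ d]).

(* Main.v *)
Require Import Defs.
From mathcomp Require Import all_boot all_order all_algebra all_fingroup.
From mathcomp Require Import cyclic zify ring.

(** Put m = n - 1.  A tableau of shape 2^k with entries at most m is a pair
    (A, B) of k-subsets of {1, ..., m}, its two columns.  Read as a word of
    length m, it has an opener at the elements of A alone, a closer at those of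
    B alone, and a neutral letter of one of two colours elsewhere.  The rows
    increase weakly exactly when every prefix of A is at least as large as the
    same prefix of B, that is, when the word is a ballot word; its parentheses
    then match up, and the tableau becomes a noncrossing matching of m points on
    a circle whose unmatched points carry one of two colours
    ([tableau_word_surj], [lin_word_surj]).

    Promotion rotates this picture.  The involution t_i exchanges the letters i
    and i + 1, except for an opener and a closer that start from height 0, which
    it leaves in place because the exchange would break the ballot condition
    ([bender_knuth_represents]).  Hence t_(m-1), ..., t_1 carry the last letter
    to the front if it is neutral; a last letter that is a closer travels until
    it stands next to its own opener, and from there on it is the opener that
    moves to the front ([slide_closer], [promotion_word]).  In particular the
    order of promotion divides m.

    Suppose that a matching is invariant under the rotation by s, where s is a
    proper divisor of m, and put e = m / s.  Orienting every arc along its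
    shorter side turns the matching into an s-periodic word.  Two diameters
    would cross, so at most one arc has no shorter side; its two ends are both
    declared openers.  So the word is an s-periodic pair of subsets of sizes
    (k, k) or (k + 1, k - 1), and the matching is recovered by matching
    parentheses cyclically ([coherent_inj], [exists_coherent],
    [card_fixed_short]).  If p(j) is the number of s-periodic j-subsets, there
    are p(k)^2 + p(k + 1) p(k - 1) fixed tableaux.  On the polynomial side,

      Nar(n, k + 1; q) = q^(k (k + 1)) ([m, k]^2 - q [m, k + 1] [m, k - 1])

    ([qNarayana_det]); it has nonnegative coefficients, because this determinant
    satisfies the recursion of ballot words on their last letter
    ([qdet_nonneg]), and its value at a primitive e-th root of unity is the same
    number by the q-Lucas theorem ([evq_qNarayana_pred]).  For e = 1 both sides
    are C(m, k)^2 - C(m, k + 1) C(m, k - 1) ([ballot_num_det]).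

    For the cyclic group of order n only the numbers of fixed points matter.  At
    a primitive e-th root of unity, e > 1 dividing n, n Nar(n, k + 1; q) equals
    (n - k) p(k)^2 + (k + 1) p(k + 1)^2, where p(j) now counts (n/e)-periodic
    j-subsets of Z/n ([evq_qNarayana_full]).  Rotating both members of a pair
    (A, B) of k-subsets preserves the difference of their sums, whereas rotating
    A alone adds k to it.  So the pairs whose difference lies in a window of
    length n - k form a proportion (n - k) / n of all pairs, and the same holds
    among the pairs fixed by any given rotation ([card_window]).  Together with
    the pairs of (k + 1)-subsets whose difference lies in a window of length
    k + 1, they have the right numbers of points fixed by the nontrivial
    rotations, but n + 1 times as many elements as there are tableaux.  If N is
    the number of tableaux and k < n - 1, the elements outside free orbits are
    few enough ([sum_model_nonfree_le]) that N free orbits can be removed; this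
    leaves N elements and changes no number of points fixed by a nontrivial
    rotation.  For k = n - 1 there is only one tableau. *)

Set Implicit Arguments.
Unset Strict Implicit.
Unset Printing Implicit Defensive.

Import Order.TTheory GRing.Theory Num.Theory.

(** * Gaussian binomial coefficients and q-Narayana polynomials *)

Local Open Scope ring_scope.

Lemma qfact_neq0 m : qfact m != 0.
Proof. by rewrite monic_neq0 // qfact_monic. Qed.

Lemma qbinom_small m r : (m < r)%N -> qbinom m r = 0.
Proof. by move=> lt_mr; rewrite /qbinom leqNgt lt_mr. Qed.

Lemma qbinom0 m : qbinom m 0 = 1.
Proof.
have /(_ isT) := @qbinomK m 0; rewrite qfact0 mul1r subn0 => H.
by apply: (mulIf (qfact_neq0 m)); rewrite H mul1r.
Qed.

Lemma qbinomnn m : qbinom m m = 1.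
Proof.
have := qbinomK (leqnn m); rewrite subnn qfact0 mulr1 => H.
by apply: (mulIf (qfact_neq0 m)); rewrite H mul1r.
Qed.

Lemma qbinom_sub m r : (r <= m)%N -> qbinom m (m - r) = qbinom m r.
Proof.
move=> le_rm.
apply: (mulIf (mulf_neq0 (qfact_neq0 r) (qfact_neq0 (m - r)))).
by rewrite qbinomK // [qfact r * _]mulrC -{3}(subKn le_rm) qbinomK ?leq_subr.
Qed.

(** Absorption: both sides equal [m + 1] [m]! / ([r]! [m - r]!). *)
Lemma qint_qbinom m r : qint m.+1 * qbinom m r = qint r.+1 * qbinom m.+1 r.+1.
Proof.
have [le_rm | lt_mr] := leqP r m; last by rewrite !qbinom_small // !mulr0.
apply: (mulIf (mulf_neq0 (qfact_neq0 r) (qfact_neq0 (m - r)))).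
rewrite -mulrA qbinomK // mulrC -qfactS.
by rewrite -(qbinomK (m := m.+1) (r := r.+1)) // subSS qfactS; ring.
Qed.

(** One of the two q-Pascal rules; it reflects [m + 1] = [r + 1] + q^(r + 1) [m - r]. *)
Lemma qbinomS m r :
  qbinom m.+1 r.+1 = qbinom m r + 'X^(r.+1) * qbinom m r.+1.
Proof.
have [lt_mr | lt_rm | ->] := ltngtP m r; first by rewrite !qbinom_small ?mulr0 ?addr0 //; lia.
  apply: (mulIf (mulf_neq0 (qfact_neq0 r.+1) (qfact_neq0 (m - r)))).
  have -> : qbinom m.+1 r.+1 * (qfact r.+1 * qfact (m - r)) = qfact m.+1.
    by rewrite -subSS qbinomK // ltnS ltnW.
  rewrite mulrDl.
  have -> : qbinom m r * (qfact r.+1 * qfact (m - r)) = qint r.+1 * qfact m.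
    by rewrite -(@qbinomK m r) 1?ltnW // qfactS; ring.
  have -> : (m - r = (m - r.+1).+1)%N by lia.
  rewrite [qfact (m - r.+1).+1]qfactS.
  transitivity ((qint r.+1 + 'X^(r.+1) * qint (m - r.+1).+1) * qfact m).
    by rewrite -qintD qfactS mulrC; congr (qint _ * _); lia.
  by rewrite mulrDl; congr (_ + _); rewrite -(@qbinomK m r.+1) //; ring.
by rewrite !qbinomnn qbinom_small // mulr0 addr0.
Qed.

(** The other q-Pascal rule, obtained from [qbinomS] by the symmetry r -> m - r. *)
Lemma qbinomSl m r : (r <= m)%N ->
  qbinom m.+1 r.+1 = qbinom m r.+1 + 'X^(m - r) * qbinom m r.
Proof.
rewrite leq_eqVlt => /predU1P [-> | lt_rm].
  by rewrite subnn !qbinomnn qbinom_small // add0r mul1r.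
rewrite -(@qbinom_sub m.+1 r.+1) ?subSS ?ltnS 1?ltnW //.
have Dm : (m - r = (m - r.+1).+1)%N by lia.
by rewrite {1}Dm qbinomS qbinom_sub // -Dm qbinom_sub 1?ltnW.
Qed.

(** Absorption pulls the factor [m + 1, k + 1] out of [m + 1] times the
    determinant, and the q-Pascal rule identifies the remaining factor
    [k + 1] [m, k] - q [m - k] [m, k - 1] with [m + 1, k]. *)
Lemma qNarayana_det m k : (0 < k)%N ->
  qNarayana m.+1 k.+1 =
    'X^(k.+1 * k) * (qbinom m k ^+ 2 - 'X * qbinom m k.+1 * qbinom m k.-1).
Proof.
case: k => // k _; rewrite [k.+1.-1]/=.
have qn0 : qint m.+1 != 0 by rewrite monic_neq0 // qint_monic.
apply: (mulIf qn0); rewrite qNarayanaK // [k.+2.-1]/= -!mulrA; congr (_ * _).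
have [lt_mk | le_km] := ltnP m k.+1.
  rewrite (@qbinom_small m k.+1) // (@qbinom_small m k.+2) ?(@qbinom_small m.+1 k.+2) //.
    by ring.
  exact: ltnW.
have E1 := qint_qbinom m k; have E2 := qint_qbinom m k.+1.
have E3 : qint m.+1 * qbinom m k.+2 = qint (m - k.+1) * qbinom m.+1 k.+2.
  have [le_k2m | ltmk2] := leqP k.+2 m; last first.
    have -> : (m - k.+1 = 0)%N by lia.
    by rewrite qbinom_small // /qint big_ord0 mul0r mulr0.
  have := qint_qbinom m (m - k.+2); rewrite qbinom_sub // => ->.
  have -> : ((m - k.+2).+1 = m - k.+1)%N by lia.
  by rewrite -(@qbinom_sub m.+1 k.+2) 1?ltnW ?subSS.
have E4 : qint k.+1 * qbinom m k.+1 = qint (m - k) * qbinom m k.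
  case: m le_km {qn0 E1 E2 E3} => // m; rewrite ltnS => le_km; rewrite -qint_qbinom.
  have := qint_qbinom m (m - k); rewrite qbinom_sub // => ->.
  have -> : ((m - k).+1 = m.+1 - k)%N by lia.
  by rewrite qbinom_sub 1?ltnW.
have E5 := qbinomSl (ltnW le_km).
have E6 : 'X * qint (m - k.+1) + 'X^(m - k) = 'X * qint (m - k) :> {poly int}.
  have -> : (m - k = (m - k.+1).+1)%N by lia.
  by rewrite qintS exprS mulrDr.
have E7 : qint k.+2 = 1 + 'X * qint k.+1 by rewrite -add1n qintD qint1 expr1.
symmetry.
transitivity (qint m.+1 * qbinom m k.+1 * qbinom m k.+1
  - 'X * (qint m.+1 * qbinom m k.+2) * qbinom m k); first by ring.
rewrite E2 E3 E7.
transitivity (qbinom m.+1 k.+2 * (qbinom m k.+1 + 'X * (qint k.+1 * qbinom m k.+1)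
  - ('X * qint (m - k.+1)) * qbinom m k)); first by ring.
by rewrite E4 E5 (_ : 'X * qint (m - k.+1) = 'X * qint (m - k) - 'X^(m - k));
  [ring | rewrite -E6; ring].
Qed.

Definition nonneg_coefs (p : {poly int}) := forall j, 0 <= p`_j.

Lemma nonneg_coefsD p q : nonneg_coefs p -> nonneg_coefs q -> nonneg_coefs (p + q).
Proof. by move=> Hp Hq j; rewrite coefD addr_ge0. Qed.

Lemma nonneg_coefsM p q : nonneg_coefs p -> nonneg_coefs q -> nonneg_coefs (p * q).
Proof. by move=> Hp Hq j; rewrite coefM sumr_ge0 // => i _; rewrite mulr_ge0. Qed.

Lemma nonneg_coefsXn n : nonneg_coefs 'X^n.
Proof. by move=> j; rewrite coefXn ler0n. Qed.

(** The elementary symmetric polynomial e_a (q, q^2, ..., q^m): its recursion in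
    m, [qelemS], involves a single power of q that does not depend on a. *)
Definition qelem (m a : nat) : {poly int} := 'X^'C(a.+1, 2) * qbinom m a.

(** The 2 x 2 dual Jacobi-Trudi determinant in the variables q, ..., q^m, which
    is the generating function of pairs of columns of lengths a and b. *)
Definition qdet (m a b : nat) : {poly int} :=
  qelem m a * qelem m b - (if b is b'.+1 then qelem m a.+1 * qelem m b' else 0).

Lemma qelemS m a : qelem m.+1 a.+1 = qelem m a.+1 + 'X^(m.+1) * qelem m a.
Proof.
rewrite /qelem; have [le_am | lt_ma] := leqP a m; last first.
  by rewrite !qbinom_small ?mulr0 ?addr0 //; lia.
rewrite qbinomSl // mulrDr !mulrA -!exprD; congr (_ + 'X^_ * _).
by rewrite binS bin1; lia.
Qed.

Lemma qelem0 m : qelem m 0 = 1.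
Proof. by rewrite /qelem qbinom0 bin_small // mul1r. Qed.

Lemma qdet_diag m a : qdet m a a.+1 = 0.
Proof. by rewrite /qdet; ring. Qed.

(** Bilinear expansion of [qelemS].  The four terms are the four possible last
    letters of a ballot word with a elements in A and b in B. *)
Lemma qdetS m a b : (b <= a)%N ->
  qdet m.+1 a b = qdet m a b
    + (if a is a'.+1 then 'X^(m.+1) * qdet m a' b else 0)
    + (if b is b'.+1 then 'X^(m.+1) * qdet m a b' else 0)
    + (if a is a'.+1 then if b is b'.+1 then 'X^(m.+1) * 'X^(m.+1) * qdet m a' b' else 0 else 0).
Proof.
case: a b => [|a] [|[|b]] // le_ba; rewrite /qdet ?qelemS ?qelem0; ring.
Qed.

(** The recursion only has nonnegative terms as long as b <= a, and the
    determinant vanishes on the boundary b = a + 1. *)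
Lemma qdet_nonneg m a b : (b <= a.+1)%N -> nonneg_coefs (qdet m a b).
Proof.
elim: m a b => [|m IHm] a b.
  have e00 c : qelem 0 c.+1 = 0 by rewrite /qelem qbinom_small // mulr0.
  case: b => [|b] le_ba; rewrite /qdet ?subr0 ?qelem0 ?mulr1.
    by case: a {le_ba} => [|a]; [rewrite qelem0; apply: (@nonneg_coefsXn 0) | rewrite e00 => j; rewrite coef0].
  by rewrite !e00 mulr0 mul0r subrr => j; rewrite coef0.
rewrite leq_eqVlt => /predU1P [-> j|]; first by rewrite qdet_diag coef0.
rewrite ltnS => le_ba; rewrite qdetS //.
have z : nonneg_coefs 0 by move=> j; rewrite coef0.
have IHX a' b' : (b' <= a'.+1)%N -> nonneg_coefs ('X^(m.+1) * qdet m a' b').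
  by move=> ?; apply/nonneg_coefsM/IHm => //; apply: nonneg_coefsXn.
apply: nonneg_coefsD; first (apply: nonneg_coefsD; first apply: nonneg_coefsD).
- by apply: IHm; apply: leqW.
- by case: a le_ba => // a ?; apply: IHX.
- by case: b le_ba => // b ?; apply: IHX; lia.
by case: a b le_ba => [|a] [|b] // ?; rewrite -mulrA; apply/nonneg_coefsM/IHX;
   [apply: nonneg_coefsXn | lia].
Qed.

Lemma qdet_qNarayana m k : (0 < k)%N -> qNarayana m.+1 k.+1 = qdet m k k.
Proof.
move=> k0; rewrite qNarayana_det //; case: k k0 => // k _.
rewrite /qdet /qelem /= mulrBr; congr (_ - _).
  transitivity ('X^('C(k.+2, 2) + 'C(k.+2, 2)) * (qbinom m k.+1 * qbinom m k.+1)); last first.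
    by rewrite exprD; ring.
  rewrite expr2; congr ('X^_ * _); have := mul_bin_diag k.+2 1; rewrite bin1 /=; lia.
transitivity ('X^((k.+2 * k.+1).+1) * (qbinom m k.+2 * qbinom m k)).
  by rewrite exprS; ring.
transitivity ('X^('C(k.+3, 2) + 'C(k.+1, 2)) * (qbinom m k.+2 * qbinom m k)); last first.
  by rewrite exprD; ring.
congr ('X^_ * _); have := mul_bin_diag k.+3 1; have := mul_bin_diag k.+1 1; rewrite !bin1 /=; nia.
Qed.

Lemma qNarayana_nonneg m k : (0 < k)%N -> nonneg_coefs (qNarayana m.+1 k.+1).
Proof. by move=> k0; rewrite qdet_qNarayana //; apply: qdet_nonneg. Qed.

(** For e dividing n, the number of k-subsets of Z/n that are invariant under the
    subgroup of order e, and the value of [n, k] at a primitive e-th root of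
    unity. *)
Definition sparse_bin (e n k : nat) : nat :=
  if (e %| k)%N then 'C(n %/ e, k %/ e) else 0.

Section Eval.
Variables (C : numClosedFieldType) (e : nat) (w : C).
Hypothesis prim_w : e.-primitive_root w.

Definition evq (p : {poly int}) : C := (map_poly intr p).[w].

Lemma evqD p q : evq (p + q) = evq p + evq q.
Proof. by rewrite /evq rmorphD hornerD. Qed.
Lemma evqB p q : evq (p - q) = evq p - evq q.
Proof. by rewrite /evq rmorphB hornerD hornerN. Qed.
Lemma evqM p q : evq (p * q) = evq p * evq q.
Proof. by rewrite /evq rmorphM hornerM. Qed.
Lemma evqXn i : evq 'X^i = w ^+ i.
Proof. by rewrite /evq map_polyXn hornerXn. Qed.
Lemma evq0 : evq 0 = 0.
Proof. by rewrite /evq rmorph0 horner0. Qed.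
Lemma evq1 : evq 1 = 1.
Proof. by rewrite /evq rmorph1 hornerC. Qed.

(** Written without division, so that w = 1 needs no separate treatment. *)
Lemma evq_qint m : evq (qint m) * (w - 1) = w ^+ m - 1.
Proof.
elim: m => [|m IHm]; first by rewrite /qint big_ord0 evq0 mul0r subrr.
by rewrite qintS evqD evqXn mulrDl IHm exprS; ring.
Qed.

Lemma evq_qint_neq0 d : ~~ (e %| d)%N -> evq (qint d) != 0.
Proof.
move=> ndv; apply: contraNneq ndv => d0.
by rewrite (prim_order_dvd prim_w) -subr_eq0 -evq_qint d0 mul0r.
Qed.

Lemma evq_qint_dvd d : (1 < e)%N -> (e %| d)%N -> evq (qint d) = 0.
Proof.
move=> e1; rewrite (prim_order_dvd prim_w) => /eqP wd.
have /eqP := evq_qint d; rewrite wd subrr mulf_eq0 => /orP [/eqP //|].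
rewrite subr_eq0 -[w]expr1 -(prim_order_dvd prim_w).
by rewrite dvdn1 => /eqP De; rewrite De in e1.
Qed.

Lemma evq_qbinom_ee d : (0 < d < e)%N -> evq (qbinom e d) = 0.
Proof.
case: d => // d /andP [_ lt_de].
have e1 : (1 < e)%N by lia.
have := qint_qbinom e.-1 d; rewrite prednK; last lia.
move=> /(congr1 evq); rewrite !evqM evq_qint_dvd // mul0r => /esym /eqP.
rewrite mulf_eq0 => /orP [d0 | /eqP //].
have /evq_qint_neq0 : ~~ (e %| d.+1)%N by apply/negP => /dvdn_leq; lia.
by rewrite d0.
Qed.

(** Induction on the upper index with [qbinomS].  When it runs through a multiple
    of e, the claim reduces to the vanishing of [e, d] for 0 < d < e. *)
Lemma qLucas a b c d : (b < e)%N -> (d < e)%N ->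
  evq (qbinom (a * e + b) (c * e + d)) = 'C(a, c)%:R * evq (qbinom b d).
Proof.
have [N DN] : {N | (a * e + b = N)%N} by exists (a * e + b)%N.
rewrite DN; elim: N a b c d DN => [|N IHN] a b c d DN lt_be lt_de.
  have Da : a = 0%N by nia.
  have Db : b = 0%N by lia.
  subst a b; case: c => [|c]; first by rewrite bin0 mul1r mul0n add0n.
  by rewrite bin0n mul0r qbinom_small ?evq0 //; nia.
case: b DN lt_be => [|b] DN lt_be.
  case: a DN => [|a] DN; first by lia.
  have DN' : (a * e + e.-1 = N)%N by nia.
  case: d lt_de => [|d] lt_de.
    case: c => [|c]; first by rewrite mul0n addn0 !qbinom0 !bin0 evq1 mul1r.
    have -> : (c.+1 * e + 0 = (c * e + e.-1).+1)%N by nia.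
    rewrite qbinomS evqD evqM evqXn.
    rewrite (IHN a e.-1 c e.-1) //; try lia.
    have -> : ((c * e + e.-1).+1 = c.+1 * e + 0)%N by nia.
    rewrite (IHN a e.-1 c.+1 0%N) //; try lia.
    rewrite qbinomnn !qbinom0 evq1 !mulr1 addn0 mulnC exprM (prim_expr_order prim_w).
    by rewrite expr1n mul1r binS natrD addrC.
  rewrite addnS qbinomS evqD evqM evqXn.
  rewrite (IHN a e.-1 c d) //; try lia.
  rewrite -addnS (IHN a e.-1 c d.+1) //; try lia.
  rewrite exprD mulnC exprM (prim_expr_order prim_w) expr1n mul1r (@qbinom_small 0) // evq0 mulr0.
  transitivity ('C(a, c)%:R * (evq (qbinom e.-1 d) + w ^+ d.+1 * evq (qbinom e.-1 d.+1))); first by ring.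
  rewrite -evqXn -evqM -evqD -qbinomS prednK; last lia.
  by rewrite evq_qbinom_ee ?mulr0.
have DN' : (a * e + b = N)%N by lia.
case: d lt_de => [|d] lt_de.
  case: c => [|c]; first by rewrite mul0n addn0 !qbinom0 !bin0 evq1 mul1r.
  have -> : (c.+1 * e + 0 = (c * e + e.-1).+1)%N by nia.
  rewrite qbinomS evqD evqM evqXn.
  rewrite (IHN a b c e.-1) //; try lia.
  have -> : ((c * e + e.-1).+1 = c.+1 * e + 0)%N by nia.
  rewrite (IHN a b c.+1 0%N) //; try lia.
  rewrite (@qbinom_small b e.-1); last lia.
  rewrite !qbinom0 evq0 evq1 mulr0 add0r addn0 mulnC exprM (prim_expr_order prim_w).
  by rewrite expr1n mul1r.
rewrite addnS qbinomS evqD evqM evqXn.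
rewrite (IHN a b c d) //; try lia.
rewrite -addnS (IHN a b c d.+1) //; try lia.
rewrite exprD mulnC exprM (prim_expr_order prim_w) expr1n mul1r.
by rewrite [in RHS]qbinomS evqD evqM evqXn; ring.
Qed.

Lemma prim_expr_dvd d : (e %| d)%N -> w ^+ d = 1.
Proof. by rewrite (prim_order_dvd prim_w) => /eqP. Qed.

Lemma evq_qbinom_dvd m k : (e %| m)%N -> evq (qbinom m k) = (sparse_bin e m k)%:R.
Proof.
move=> /divnK Dm; have e0 : (0 < e)%N := prim_order_gt0 prim_w.
rewrite -{1}Dm -[(_ * _)%N]addn0 {1}(divn_eq k e) qLucas ?ltn_mod //.
rewrite /sparse_bin /dvdn; case: eqP => [->|/eqP nk].
  by rewrite qbinom0 evq1 mulr1.
by rewrite qbinom_small ?lt0n // evq0 mulr0.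
Qed.

Lemma evq_qNarayana1 m k : e = 1%N -> (0 < k)%N ->
  evq (qNarayana m.+1 k.+1) + ('C(m, k.+1) * 'C(m, k.-1))%:R = ('C(m, k) ^ 2)%:R.
Proof.
move=> e1 k0; have em : (e %| m)%N by rewrite e1 dvd1n.
rewrite qNarayana_det // evqM evqXn evqB expr2 !evqM !evq_qbinom_dvd // -['X]expr1 evqXn.
by rewrite !prim_expr_dvd ?e1 ?dvd1n // /sparse_bin !dvd1n !divn1 natrM natrX; ring.
Qed.

(** In [qNarayana_det] at most one of the two products survives: the second
    needs e to divide both k + 1 and k - 1, hence e = 2, w = -1, and then the
    sign of - q becomes positive. *)
Lemma evq_qNarayana_pred m k : (0 < k)%N -> (1 < e)%N -> (e %| m)%N ->
  evq (qNarayana m.+1 k.+1) =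
    (sparse_bin e m k ^ 2 + sparse_bin e m k.+1 * sparse_bin e m k.-1)%:R.
Proof.
move=> k0 e1 em; rewrite qNarayana_det // evqM evqXn evqB expr2 !evqM.
rewrite !evq_qbinom_dvd // -['X]expr1 evqXn expr1 natrD natrM natrX expr2.
have [ek | nek] := boolP (e %| k)%N.
  rewrite prim_expr_dvd ?dvdn_mull // mul1r.
  have -> : sparse_bin e m k.+1 = 0%N.
    by rewrite /sparse_bin -addn1 dvdn_addr // dvdn1; case: eqP => // e1'; rewrite e1' in e1.
  ring.
have -> : sparse_bin e m k = 0%N by rewrite /sparse_bin (negbTE nek).
rewrite mulr0n mul0r sub0r add0r.
have [ek1 | nek1] := boolP (e %| k.+1)%N; last first.
  have -> : sparse_bin e m k.+1 = 0%N by rewrite /sparse_bin (negbTE nek1).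
  ring.
have [ek2 | nek2] := boolP (e %| k.-1)%N; last first.
  have -> : sparse_bin e m k.-1 = 0%N by rewrite /sparse_bin (negbTE nek2).
  ring.
have De : e = 2%N.
  have : (e %| k.+1 - k.-1)%N by apply: dvdn_sub.
  rewrite (_ : (k.+1 - k.-1)%N = 2%N); last lia.
  by move=> /dvdn_leq; lia.
have w1 : w = -1.
  have /eqP : w ^+ 2 = 1 by rewrite prim_expr_dvd // De.
  rewrite sqrf_eq1 => /orP [|/eqP //]; rewrite -[w]expr1 -(prim_order_dvd prim_w).
  by rewrite dvdn1 => /eqP De'; rewrite De' in e1.
by rewrite prim_expr_dvd ?dvdn_mulr // mul1r {1}w1; ring.
Qed.

(** [m + 1] vanishes at w, so its division has to be undone first: absorption
    gives Nar [k + 1] = q^(k (k + 1)) [m, k] [m + 1, k] and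
    Nar [k] = q^(k (k + 1)) [m + 1, k + 1] [m, k - 1].  The first identity is
    used unless e divides k + 1, the second one when it does. *)
Lemma evq_qNarayana_full m k : (0 < k)%N -> (1 < e)%N -> (e %| m.+1)%N ->
  evq (qNarayana m.+1 k.+1) * m.+1%:R =
    ((m.+1 - k) * sparse_bin e m.+1 k ^ 2 + k.+1 * sparse_bin e m.+1 k.+1 ^ 2)%:R.
Proof.
move=> k0 e1 em.
have qn0 : qint m.+1 != 0 by rewrite monic_neq0 // qint_monic.
pose f := qNarayana m.+1 k.+1; pose X := 'X^(k.+1 * k) : {poly int}.
have Df : f * qint m.+1 = X * qbinom m.+1 k.+1 * qbinom m.+1 k by rewrite qNarayanaK.
have f1 : f * qint k.+1 = X * qbinom m k * qbinom m.+1 k.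
  apply: (mulIf qn0); transitivity ((f * qint m.+1) * qint k.+1); first by ring.
  rewrite Df; transitivity (X * (qint k.+1 * qbinom m.+1 k.+1) * qbinom m.+1 k); first by ring.
  by rewrite -qint_qbinom; ring.
have f2 : f * qint k = X * qbinom m.+1 k.+1 * qbinom m k.-1.
  apply: (mulIf qn0); transitivity ((f * qint m.+1) * qint k); first by ring.
  rewrite Df; transitivity (X * qbinom m.+1 k.+1 * (qint k * qbinom m.+1 k)); first by ring.
  by have := qint_qbinom m k.-1; rewrite prednK // => <-; ring.
rewrite -/f.
move/(congr1 evq): f1; rewrite !evqM evqXn (evq_qbinom_dvd _ em) => f1.
move/(congr1 evq): f2; rewrite !evqM evqXn (evq_qbinom_dvd _ em) => f2.
pose s := (m.+1 %/ e)%N; have Ds : (m.+1 = s * e)%N by rewrite divnK.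
have s0 : (0 < s)%N by nia.
have Dm : (m = s.-1 * e + e.-1)%N by nia.
have [ek | nek] := boolP (e %| k)%N.
  have nek1 : ~~ (e %| k.+1)%N.
    by rewrite -addn1 dvdn_addr // dvdn1 neq_ltn e1 orbT.
  rewrite qintS evqD evq_qint_dvd // evqXn (prim_expr_dvd ek) add0r mulr1 in f1.
  rewrite prim_expr_dvd ?dvdn_mull // mul1r in f1.
  rewrite /sparse_bin (negbTE nek1) ek muln0 addn0 in f1 *.
  have Dk := divnK ek; set j := (k %/ e)%N in f1 Dk *.
  rewrite f1 {1}Dm -{1}Dk -[(j * e)%N]addn0 qLucas; try lia.
  rewrite qbinom0 evq1 mulr1 -!natrM; congr _%:R.
  rewrite -/s Ds -[in RHS]Dk -mulnBl -mulnn.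
  transitivity (e * 'C(s, j) * (s * 'C(s.-1, j)))%N; first by ring.
  by rewrite mul_bin_down; ring.
have [ek1 | nek1] := boolP (e %| k.+1)%N; last first.
  rewrite /sparse_bin (negbTE nek) (negbTE nek1) !muln0 in f1 f2 *.
  move: f1; rewrite mulr0 => /eqP.
  by rewrite mulf_eq0 (negbTE (evq_qint_neq0 nek1)) orbF => /eqP ->; rewrite mul0r.
have Dk := divnK ek1; set j := (k.+1 %/ e)%N in Dk.
have j0 : (0 < j)%N by nia.
have qe : qbinom e.-1 e.-2 = qint e.-1.
  have := @qbinom_sub e.-1 1; rewrite subn1 => -> //; last lia.
  have := qint_qbinom e.-2 0; rewrite qbinom0 qint1 mulr1 mul1r prednK //; lia.
have Dkp : (k.-1 = j.-1 * e + e.-2)%N by nia.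
have Dk' : (k = j.-1 * e + e.-1)%N by nia.
move: f2; rewrite prim_expr_dvd ?dvdn_mulr // mul1r.
have -> : evq (qbinom m k.-1) = 'C(s.-1, j.-1)%:R * evq (qbinom e.-1 e.-2).
  by rewrite {1}Dm {1}Dkp qLucas //; lia.
have -> : evq (qint k) = evq (qint e.-1).
  by rewrite Dk' qintD evqD evqM evqXn evq_qint_dvd ?dvdn_mull // prim_expr_dvd ?dvdn_mull // add0r mul1r.
rewrite qe mulrA => /mulIf -> ; last first.
  by apply: evq_qint_neq0; apply/negP => /dvdn_leq; lia.
rewrite /sparse_bin (negbTE nek) ek1 muln0 add0n -natrM -natrM; congr _%:R.
rewrite -/s -/j; have := mul_bin_diag s j.-1; rewrite prednK // => H.
rewrite Ds -Dk -mulnn.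
transitivity (e * 'C(s, j) * (s * 'C(s.-1, j.-1)))%N; first by ring.
by rewrite H; ring.
Qed.

End Eval.

(** * Cyclic sieving for a permutation of finite order *)

(** Reduces integer exponents, for group elements and roots of unity alike, to natural ones. *)
Lemma expgz_exp (gT : finGroupType) (g : gT) (d : int) :
  exists2 i : nat, expgz g d = (g ^+ i)%g &
    forall (R : unitRingType) (z : R), z ^+ #[g]%g = 1 -> z ^ d = z ^+ i.
Proof.
case: d => [i|i]; first by exists i.
exists (#[g]%g.-1 * i.+1)%N => [|R z z1] /=.
  apply/(mulIg (g ^+ i.+1)%g); rewrite mulVg -expgD addnC -mulSn.
  by rewrite prednK ?order_gt0 // expgM expg_order expg1n.
have zi : z ^+ (#[g]%g.-1 * i.+1)%N * z ^+ i.+1 = 1.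
  by rewrite -exprD addnC -mulSn prednK ?order_gt0 // exprM z1 expr1n.
have ziC : z ^+ i.+1 * z ^+ (#[g]%g.-1 * i.+1)%N = 1.
  by rewrite -exprD addnC exprD.
have zu : z ^+ i.+1 \is a GRing.unit.
  by apply/unitrP; exists (z ^+ (#[g]%g.-1 * i.+1)%N).
by apply: (mulIr zu); rewrite zi NegzE -invr_expz -exprnP mulVr.
Qed.

(** Bezout: fixed points only depend on the subgroup generated by the power. *)
Lemma fix_expg_gcd (X : finType) (P : {perm X}) N d :
  (P ^+ N = 1)%g -> [set x | (P ^+ d)%g x == x] = [set x | (P ^+ gcdn d N)%g x == x].
Proof.
move=> PN; apply/setP=> x; rewrite !inE; apply/eqP/eqP => [Px | Px].
  have [->|d0] := posnP d; first by rewrite gcd0n PN perm1.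
  have [a b Dab _] := egcdnP N d0.
  have <- : (P ^+ (a * d) = P ^+ gcdn d N)%g.
    by rewrite Dab expgD (mulnC b N) expgM PN expg1n mul1g.
  rewrite mulnC expgM; elim: {Dab} a => [|a IHa]; first by rewrite expg0 perm1.
  by rewrite expgSr permM IHa Px.
rewrite -(divnK (dvdn_gcdl d N)) mulnC expgM.
by elim: (_ %/ _)%N => [|a IHa]; rewrite ?expg0 ?perm1 // expgSr permM IHa Px.
Qed.

(** The action need not be faithful, so the group is taken to be Z/N, acting
    through the morphism that sends a generator to P; only exponents dividing N
    have to be examined. *)
Lemma cyclic_sieving_of_perm (C : numClosedFieldType) (X : finType)
    (P : {perm X}) (N : nat) (f : {poly int}) :
  (0 < N)%N -> (P ^+ N = 1)%g -> nonneg_coefs f ->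
  (forall s, (s %| N)%N -> forall w : C, (N %/ s).-primitive_root w ->
     #|[set x | (P ^+ s)%g x == x]|%:R = evq w f) ->
  exists (gT : finGroupType) (g : gT) (to : action <[g]>%g X),
    [/\ #[g]%g = N, forall x, to x g = P x & cyclic_sieving C to f].
Proof.
case: N => // N _ PN f_ge0 fixP.
have ordP : (#[P]%g %| #[@Zp1 N]%g)%N by rewrite order_Zp1 order_dvdn PN.
exists 'I_N.+1, Zp1, (morph_action (eltm_morphism ordP)); split.
- exact: order_Zp1.
- by move=> x; rewrite /= /mact /= eltm_id.
split=> // xi; rewrite order_Zp1 => xi_prim d.
have [i -> zi] := expgz_exp (@Zp1 N) d.
rewrite zi ?order_Zp1 ?(prim_expr_order xi_prim) //.
transitivity (#|[set x | (P ^+ gcdn i N.+1)%g x == x]|%:R : C).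
  by rewrite -fix_expg_gcd //; congr (_%:R); apply: eq_card => x; rewrite !inE /= /mact /= eltmE.
by rewrite (fixP _ (dvdn_gcdr _ _) (xi ^+ i)) // exp_prim_root.
Qed.

(** Transport of an injective self-map along a bijection onto an invariant subset. *)
Lemma perm_of_stable (X Z : finType) (r : Z -> Z) (beta : X -> Z) :
    injective r -> injective beta ->
    (forall x, r (beta x) \in codom beta) ->
  exists P : {perm X},
    (forall s x, beta ((P ^+ s)%g x) = iter s r (beta x)) /\
    (forall s, #|[set x | (P ^+ s)%g x == x]|
               = #|[set z in codom beta | iter s r z == z]|).
Proof.
move=> r_inj beta_inj stable.
pose p x := iinv (stable x).
have Dp x : beta (p x) = r (beta x) by rewrite f_iinv.
have p_inj : injective p by move=> x y Exy; apply/beta_inj/r_inj; rewrite -!Dp Exy.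
have DP s x : beta ((perm p_inj ^+ s)%g x) = iter s r (beta x).
  elim: s => [|s IHs]; first by rewrite expg0 perm1.
  by rewrite expgSr permM permE Dp IHs.
exists (perm p_inj); split=> // s.
rewrite -(card_imset _ beta_inj); apply: eq_card => z; rewrite !inE.
apply/imsetP/andP => [[x] | [/codomP [x ->] /eqP zs]].
  by rewrite inE => /eqP Px ->; rewrite codom_f -DP Px.
by exists x; rewrite // inE -(inj_eq beta_inj) DP zs.
Qed.

(** * Rotation of subsets of a cycle *)

Local Close Scope ring_scope.

Definition rotset n (A : {set 'I_n}) : {set 'I_n} := @ordS n @: A.

Lemma ordS_inj n : injective (@ordS n).
Proof. exact: can_inj (@ordSK n). Qed.

Lemma rotset_inj n : injective (@rotset n).
Proof. exact: imset_inj (@ordS_inj n). Qed.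

Lemma mem_rotset n (A : {set 'I_n}) i : (@ordS n i \in rotset A) = (i \in A).
Proof. exact: mem_imset (@ordS_inj n). Qed.

Lemma card_rotset n (A : {set 'I_n}) : #|rotset A| = #|A|.
Proof. exact: card_imset (@ordS_inj n). Qed.

Lemma mem_iter_rotset n s (A : {set 'I_n}) i :
  (iter s (@ordS n) i \in iter s (@rotset n) A) = (i \in A).
Proof. by elim: s => //= s IHs; rewrite mem_rotset. Qed.

Lemma iter_ordS n s (i : 'I_n) : iter s (@ordS n) i = (i + s) %% n :> nat.
Proof.
elim: s => [|s IHs] /=; first by rewrite addn0 modn_small.
by rewrite IHs -addn1 modnDml -addnA addn1.
Qed.

Lemma iter_ordS_full n (i : 'I_n) : iter n (@ordS n) i = i.
Proof. by apply: val_inj; rewrite /= iter_ordS modnDr modn_small. Qed.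

Lemma iter_ordS_inj n s : injective (iter s (@ordS n)).
Proof. by elim: s => [|s IHs] //= i j /ordS_inj /IHs. Qed.

Lemma iter_ordS_surj n s (i : 'I_n) : exists j, i = iter s (@ordS n) j.
Proof. by exists (iter s (@ord_pred n) i); elim: s i => // s IHs i; rewrite iterSr iterS ord_predK. Qed.

Lemma periodicP n s (A : {set 'I_n}) :
  reflect (forall i, (iter s (@ordS n) i \in A) = (i \in A))
          (iter s (@rotset n) A == A).
Proof.
apply: (iffP eqP) => [E i | E]; first by rewrite -{1}E mem_iter_rotset.
apply/setP=> i; have [j ->] := iter_ordS_surj s i.
by rewrite mem_iter_rotset E.
Qed.

Lemma iter_rotset_full n (A : {set 'I_n}) : iter n (@rotset n) A = A.
Proof. by apply/eqP/periodicP => i; rewrite iter_ordS_full. Qed.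

Lemma sum_modn e s (F : nat -> nat) :
  \sum_(0 <= i < e * s) F (i %% s) = e * \sum_(0 <= i < s) F i.
Proof.
elim: e => [|e IHe]; first by rewrite !mul0n big_geq.
rewrite mulSnr (@big_cat_nat _ _ _ (e * s)) ?leq_addr //= IHe mulSnr.
congr (_ + _); rewrite -{1}[e * s]add0n big_addn addKn.
rewrite !big_nat; apply: eq_bigr => i /andP [_ lt_is].
by rewrite addnC modnMDl modn_small.
Qed.

Section Periodic.
Variables (n s : nat).
Hypotheses (n_gt0 : 0 < n) (s_dvd : s %| n).

Let s_gt0 : 0 < s. Proof. exact: dvdn_gt0 s_dvd. Qed.

(** The inverse image of D under the reduction map Z/n -> Z/s. *)
Definition lift_periodic (D : {set 'I_s}) : {set 'I_n} :=
  [set i : 'I_n | Ordinal (ltn_pmod i s_gt0) \in D].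

Lemma card_lift_periodic D : #|lift_periodic D| = n %/ s * #|D|.
Proof.
pose F i := nat_of_bool (Ordinal (ltn_pmod i s_gt0) \in D).
have F_mod i : F (i %% s) = F i.
  by congr (nat_of_bool (_ \in D)); apply: val_inj; rewrite /= modn_mod.
rewrite -sum1_card big_mkcond /=.
transitivity (\sum_(i < n) F i).
  by apply: eq_bigr => i _; rewrite inE /F; case: (_ \in _).
rewrite -(big_mkord predT F) -{1}(divnK s_dvd).
under eq_bigr => i _ do rewrite -F_mod.
rewrite sum_modn; congr (_ * _); rewrite big_mkord -sum1_card [RHS]big_mkcond /=.
apply: eq_bigr => i _; rewrite /F (_ : Ordinal _ = i); first by case: (_ \in _).
by apply: val_inj; rewrite /= modn_small.
Qed.

Lemma lift_periodic_inj : injective lift_periodic.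
Proof.
move=> D D' /setP E; apply/setP=> j.
have le_sn : s <= n := dvdn_leq n_gt0 s_dvd.
have := E (widen_ord le_sn j); rewrite !inE.
by rewrite (_ : Ordinal _ = j) //; apply: val_inj; rewrite /= modn_small.
Qed.

Lemma lift_periodicP (A : {set 'I_n}) :
  reflect (exists D, A = lift_periodic D) (iter s (@rotset n) A == A).
Proof.
apply: (iffP (periodicP s A)) => [E | [D ->] i]; last first.
  rewrite !inE; congr (_ \in D); apply: val_inj; rewrite /= iter_ordS.
  by rewrite modn_dvdm // modnDr.
have le_sn : s <= n := dvdn_leq n_gt0 s_dvd.
exists [set j : 'I_s | widen_ord le_sn j \in A]; apply/setP=> i; rewrite !inE.
set i0 := widen_ord _ _.
have -> : i = iter (i %/ s * s) (@ordS n) i0 by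
  apply: val_inj; rewrite /= iter_ordS /= addnC -divn_eq modn_small.
by elim: (i %/ s) => // a IHa; rewrite mulSn iterD E.
Qed.

Lemma card_periodic k :
  #|[set A : {set 'I_n} | (iter s (@rotset n) A == A) && (#|A| == k)]|
    = sparse_bin (n %/ s) n k.
Proof.
have e_gt0 : 0 < n %/ s by rewrite divn_gt0 // dvdn_leq.
have -> : [set A : {set 'I_n} | (iter s (@rotset n) A == A) && (#|A| == k)]
    = lift_periodic @: [set D : {set 'I_s} | n %/ s * #|D| == k].
  apply/setP=> A; rewrite !inE; apply/andP/imsetP => [[/lift_periodicP [D ->] cA] | [D]].
    by exists D; rewrite // inE -card_lift_periodic.
  rewrite inE -card_lift_periodic => cD ->; split=> //.
  by apply/lift_periodicP; exists D.
rewrite card_imset; last exact: lift_periodic_inj.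
rewrite /sparse_bin divnA // mulKn //; case: ifP => [/dvdnP [j ->] | nk].
  rewrite mulnK // -[in RHS](card_ord s) -card_draws; apply: eq_card => D.
  by rewrite !inE mulnC eqn_pmul2r.
apply: eq_card0 => D; rewrite !inE; apply/eqP => Dk.
by rewrite -Dk dvdn_mulr in nk.
Qed.

End Periodic.

(** * Noncrossing matchings of points on a circle *)

(** The number of steps from i to j in the direction of rotation, for i, j < n. *)
Definition cdist (n i j : nat) : nat := if i <= j then j - i else n + j - i.

Lemma cdistP n i j : i < n -> j < n ->
  (i <= j /\ i + cdist n i j = j) \/ (j < i /\ i + cdist n i j = n + j).
Proof. by move=> lt_in lt_jn; rewrite /cdist; case: leqP => ?; [left | right]; split=> //; lia. Qed.

Lemma cdist_ordS n (i j : 'I_n) : cdist n (ordS i) (ordS j) = cdist n i j.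
Proof.
have ordSE (k : 'I_n) : (k.+1 = n /\ ordS k = 0 :> nat) \/ (k.+1 < n /\ ordS k = k.+1 :> nat).
  have := ltn_ord k; rewrite leq_eqVlt => /predU1P [Dk | lt_kn]; [left | right]; split=> //=.
    by rewrite Dk modnn.
  by rewrite modn_small.
have := cdistP (ltn_ord i) (ltn_ord j).
have := cdistP (ltn_ord (ordS i)) (ltn_ord (ordS j)).
have := ltn_ord i; have := ltn_ord j.
by case: (ordSE i) => [] []; case: (ordSE j) => [] []; lia.
Qed.

Ltac card_lia := unfold reverse_coercion in *; lia.

Ltac cdist_facts i j := have := cdistP (ltn_ord i) (ltn_ord j);
  have := ltn_ord i; have := ltn_ord j.

Section Matching.
Variable n : nat.
Implicit Types (pi : {perm 'I_n}) (i j p q r t : 'I_n) (U D A B : {set 'I_n}).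

Local Notation d := (cdist n).

Lemma cdist_eq0 i j : d i j = 0 -> i = j.
Proof. by move=> dij; apply: ord_inj; have := ltn_ord i; cdist_facts i j; lia. Qed.

(** The points strictly after i and before its partner are matched among
    themselves.  In terms of [cdist] the condition is visibly invariant under
    rotation. *)
Definition noncrossing pi : bool :=
  [forall i : 'I_n, forall j : 'I_n, (j != i) && (d i j < d i (pi i)) ==> (d i (pi j) < d i (pi i))].

Definition nc_matching pi : bool := [forall i, pi (pi i) == i] && noncrossing pi.

Lemma nc_matchingP pi :
  reflect ((forall i, pi (pi i) = i)
           /\ (forall i j, j <> i -> d i j < d i (pi i) -> d i (pi j) < d i (pi i)))
          (nc_matching pi).
Proof.
apply: (iffP andP) => [[/forallP inv nc] | [inv nc]]; split.
- by move=> i; apply/eqP.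
- move=> i j /eqP ji dij; move/forallP/(_ i)/forallP/(_ j)/implyP: nc; apply.
  by rewrite ji.
- by apply/forallP => i; rewrite inv.
by apply/forallP => i; apply/forallP => j; apply/implyP => /andP [/eqP]; apply: nc.
Qed.

(** The set U of openers and the set D of closers orient the arcs of the
    matching: each closer is matched with an opener, and every arc below it
    points in the same direction.  Two openers may be matched with each other;
    this allows for a diameter, which has no preferred direction. *)
Definition coherent U D pi : Prop :=
  [/\ nc_matching pi,
      forall i, (pi i != i) = (i \in U) || (i \in D),
      forall q, q \in D -> pi q \in U
    & forall q j, q \in D -> 0 < d j q < d (pi q) q ->
        (j \in U -> pi j \in D /\ d (pi j) q < d j q) /\ (j \in D -> d j q < d (pi j) q)].

Lemma coherent_arc U D pi q j : coherent U D pi -> q \in D ->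
  0 < d j q < d (pi q) q -> d (pi j) q < d (pi q) q.
Proof.
case=> /nc_matchingP [inv nc] _ _ _ qD jq.
have : d (pi q) (pi j) < d (pi q) q.
  have := nc (pi q) j; rewrite inv; apply.
    by move=> Dj; rewrite Dj ltnn andbF in jq.
  by cdist_facts (pi q) j; cdist_facts j q; cdist_facts (pi q) q; have := ltn_ord q; lia.
have : 0 < d (pi q) (pi j).
  rewrite lt0n; apply/eqP => /cdist_eq0 /perm_inj Eq; move: jq.
  by rewrite -Eq; cdist_facts q q; lia.
by cdist_facts (pi q) (pi j); cdist_facts (pi j) q; cdist_facts (pi q) q; lia.
Qed.

(** Cyclic matching of parentheses is unique.  If the two partners of q differ,
    the nearer one is an opener below the longer arc, so the second matching
    closes it at a point t before q; the arc of t in the first matching is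
    shorter than the one of q, and induction on the length identifies the two
    partners of t, which is absurd. *)
Lemma coherent_closer U D pi pi' : [disjoint U & D] ->
  coherent U D pi -> coherent U D pi' -> {in D, pi =1 pi'}.
Proof.
move=> dUD coh coh' q; have [N] := ubnP (minn (d (pi q) q) (d (pi' q) q)).
elim: N q pi pi' coh coh' => // N IHN q pi pi' coh coh' leN qD.
wlog lt_rr' : pi pi' coh coh' leN / d (pi q) q < d (pi' q) q.
  move=> H; have [lt | lt | E] := ltngtP (d (pi q) q) (d (pi' q) q).
  - exact: H.
  - by apply/esym/H; rewrite // minnC.
  by apply: ord_inj; cdist_facts (pi q) q; cdist_facts (pi' q) q; have := ltn_ord (pi q); have := ltn_ord (pi' q); lia.
case: (coh) => /nc_matchingP [inv nc] mv DU cl.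
case: (coh') => /nc_matchingP [inv' nc'] mv' DU' cl'.
have rq : 0 < d (pi q) q.
  rewrite lt0n; apply/eqP => /cdist_eq0 /eqP; apply/negP; rewrite mv qD; exact: orbT.
have [/(_ (DU _ qD)) [tD lt_tr] _] := cl' q (pi q) qD (introT andP (conj rq lt_rr')).
set t := pi' (pi q) in tD lt_tr.
have tq : 0 < d t q.
  rewrite lt0n; apply/eqP => /cdist_eq0 Et; move: lt_rr'.
  by rewrite (_ : pi' q = pi q) ?ltnn // -{1}Et inv'.
have [_ /(_ tD) lt_tu] := cl q t qD (introT andP (conj tq lt_tr)).
have lt_ur := coherent_arc coh qD (introT andP (conj tq lt_tr)).
have Et : pi t = pi' t.
  apply: IHN => //; move: leN.
  by cdist_facts (pi t) t; cdist_facts (pi t) q; cdist_facts t q; lia.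
by move: lt_ur; rewrite Et /t inv' ltnn.
Qed.

Definition leftover U pi := [set i in U | pi i \in U].

Lemma card_leftover U D pi : [disjoint U & D] -> coherent U D pi ->
  #|U| = #|D| + #|leftover U pi|.
Proof.
move=> dUD [/nc_matchingP [inv _] mv DU _].
have imD i : (i \in pi @: D) = (pi i \in D).
  apply/imsetP/idP => [[q qD ->] | piD]; first by rewrite inv.
  by exists (pi i); rewrite ?inv.
rewrite -(card_imset (mem D) (@perm_inj _ pi)) -cardsUI.
have -> : pi @: D :&: leftover U pi = set0.
  apply/setP=> i; rewrite in_setI imD !inE; apply/negP => /andP [piD /andP [_ piU]].
  by rewrite (disjointFr dUD piU) in piD.
rewrite cards0 addn0; apply: eq_card => i; rewrite in_setU imD inE.
apply/idP/orP => [iU | [/DU | /andP[] //]]; last by rewrite inv.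
have pi_i : pi i != i by rewrite mv iU.
by have := mv (pi i); rewrite inv eq_sym pi_i iU orbC => /esym/orP.
Qed.

(** Closers are settled by [coherent_closer]; at most two openers are left, and
    these can only be matched with each other. *)
Lemma coherent_inj U D pi pi' : [disjoint U & D] -> #|U| <= #|D| + 2 ->
  coherent U D pi -> coherent U D pi' -> pi = pi'.
Proof.
move=> dUD cU coh coh'.
have eqD := coherent_closer dUD coh coh'.
have cL := card_leftover dUD coh.
case: (coh) => /nc_matchingP [inv _] mv DU _.
case: (coh') => /nc_matchingP [inv' _] mv' DU' _.
have toD i : (pi i \in D) -> pi i = pi' i.
  by move=> piD; apply: (canRL inv'); rewrite -eqD // inv.
have toD' i : (pi' i \in D) -> pi i = pi' i.
  by move=> piD; apply/esym/(canRL inv); rewrite eqD // inv'.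
apply/permP => i.
have [iUD | iUD] := boolP ((i \in U) || (i \in D)); last first.
  by have := mv i; have := mv' i; rewrite (negbTE iUD) => /negbFE/eqP -> /negbFE/eqP ->.
have [/eqD // | niD] := boolP (i \in D); rewrite (negbTE niD) orbF in iUD.
have [/toD // | npD] := boolP (pi i \in D).
have [/toD' // | npD'] := boolP (pi' i \in D).
have mi := mv i; have mi' := mv' i; rewrite iUD /= in mi mi'.
have pU : pi i \in U by have := mv (pi i); rewrite inv eq_sym mi (negbTE npD) orbF => <-.
have pU' : pi' i \in U by have := mv' (pi' i); rewrite inv' eq_sym mi' (negbTE npD') orbF => <-.
apply/eqP/negPn/negP => ne.
have sub : [set i; pi i; pi' i] \subset leftover U pi.
  apply/subsetP => j; rewrite !inE => /orP [/orP [] |] /eqP ->; rewrite ?iUD ?pU ?pU' ?inv //=.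
  have ne2 : pi (pi' i) != pi' i by rewrite mv pU'.
  have := mv (pi (pi' i)); rewrite inv eq_sym ne2.
  case/esym/orP => // /[dup] Dq /toD E; move: Dq; rewrite E inv' => iD.
  by rewrite iD in niD.
have := subset_leq_card sub.
rewrite setUC cardsU1 cards2 !inE negb_or [pi' i == pi i]eq_sym [i == _]eq_sym mi mi' ne /=.
by move=> le3; have := leq_trans le3 (_ : _ <= 2); rewrite -(leq_add2l #|D|) -cL => /(_ cU).
Qed.

Lemma coherent_matching U D pi : coherent U D pi -> nc_matching pi.
Proof. by case. Qed.

(** For a pair (p, q) at minimal distance, an opener in between would be closer
    to q and a closer in between would be closer to p. *)
Lemma closest_pair U D p0 q0 : [disjoint U & D] -> p0 \in U -> q0 \in D ->
  exists p q, [/\ p \in U, q \in D &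
    forall j, 0 < d p j < d p q -> (j \notin U) && (j \notin D)].
Proof.
move=> dUD p0U q0D.
pose P (x : 'I_n * 'I_n) := (x.1 \in U) && (x.2 \in D).
have P0 : P (p0, q0) by rewrite /P p0U.
case: (arg_minnP (fun x : 'I_n * 'I_n => d x.1 x.2) P0) => -[p q] /andP /= [pU qD] mind.
exists p, q; split=> // j jpq; apply/andP; split; apply/negP => jX.
  have := mind (j, q); rewrite /P /= jX qD => /(_ isT); move: jpq.
  by cdist_facts p j; cdist_facts p q; cdist_facts j q; lia.
by have := mind (p, j); rewrite /P /= jX pU => /(_ isT); move: jpq; lia.
Qed.

(** Induction on the number of closers: match a closest pair, turn both ends
    into neutral letters, and match the rest.  Without closers there are zero or
    two openers. *)
Lemma exists_coherent U D : [disjoint U & D] ->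
  #|U| = #|D| \/ #|U| = #|D| + 2 -> exists pi, coherent U D pi.
Proof.
have [N] := ubnP #|D|; elim: N U D => // N IHN U D leN dUD cU.
have [D0 | [q0 q0D]] := set_0Vmem D.
  subst D; rewrite cards0 add0n in cU; case: cU => cU.
    move/cards0_eq: cU => ->; exists 1%g; split=> [|i|q|q j]; rewrite ?inE ?perm1 ?eqxx //.
    apply/nc_matchingP; split=> [i|i j _]; rewrite ?perm1 //; by cdist_facts i i; lia.
  have /cards2P [p [q [npq ->]]] : #|U| == 2 by rewrite cU.
  exists (tperm p q); split=> [|i|t|t j]; rewrite ?inE //.
    apply/nc_matchingP; split=> [i|i j nji]; first exact: tpermK.
    move: nji; case: (tpermP p q i) => [->|->|ip iq] nji.
    - by case: (tpermP p q j) => [/nji|->|] //; rewrite ltnn.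
    - by case: (tpermP p q j) => [->|/nji|] //; rewrite ltnn.
    by cdist_facts i i; lia.
  rewrite orbF; case: tpermP => [->|->|/eqP/negbTE-> /eqP/negbTE->]; rewrite ?eqxx ?orbT //.
    by rewrite eq_sym.
have [p0 p0U] : exists p0, p0 \in U.
  apply/set0Pn; rewrite -card_gt0; have : 0 < #|D| by apply/card_gt0P; exists q0.
  by move=> D0; case: cU => ->; rewrite ?addn_gt0 D0.
have [p [q [pU qD clos]]] := closest_pair dUD p0U q0D.
have npq : p != q by apply: contraTneq qD => <-; rewrite (disjointFr dUD pU).
have npq' : p <> q by apply/eqP.
have cU' := cardsD1 p U; have cD' := cardsD1 q D; rewrite pU in cU'; rewrite qD in cD'.
have [|||pi coh] := IHN (U :\ p) (D :\ q).
- by card_lia.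
- apply: disjointWl (subsetDl _ _) _; exact: disjointWr (subsetDl _ _) dUD.
- by case: cU; [left | right]; card_lia.
case: (coh) => /nc_matchingP [inv nc] mv DU cl.
have pD : p \notin D by rewrite (disjointFr dUD pU).
have qU : q \notin U by rewrite (disjointFl dUD qD).
have pip : pi p = p.
  by apply/eqP; rewrite -[_ == _]negbK mv !inE eqxx (negbTE pD) andbF.
have piq : pi q = q.
  by apply/eqP; rewrite -[_ == _]negbK mv !inE eqxx (negbTE qU) andbF.
have pij j : 0 < d p j < d p q -> pi j = j.
  move=> /clos /andP [jU jD].
  by apply/eqP; rewrite -[_ == _]negbK mv !inE (negbTE jU) (negbTE jD) !andbF.
(* pi fixes p and q; pi2 matches them with each other instead *)
pose pi2 := (pi * tperm p q)%g.
have pi2p : pi2 p = q by rewrite permM pip tpermL.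
have pi2q : pi2 q = p by rewrite permM piq tpermR.
have nep j : j <> p -> pi j <> p by move=> njp E; apply: njp; rewrite -(inv j) E.
have neq j : j <> q -> pi j <> q by move=> njq E; apply: njq; rewrite -(inv j) E.
have pi2E j : j <> p -> j <> q -> pi2 j = pi j.
  by move=> njp njq; rewrite permM tpermD // eq_sym; apply/eqP; [apply: nep | apply: neq].
(* points outside the short arc see p and q on the same side *)
have outside j : j <> p -> j <> q -> pi j <> j -> d p q < d p j.
  move=> njp njq nj; case: (ltngtP (d p q) (d p j)) => // [lt | E].
    have : 0 < d p j by rewrite lt0n; apply/eqP => /cdist_eq0 Ej; apply: njp.
    by move=> j0; case: nj; apply: pij; rewrite j0.
  by case: njq; apply: ord_inj; move: E; cdist_facts p q; cdist_facts p j; clear; lia.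
have dne (i j : 'I_n) : i <> j -> nat_of_ord i <> j by move=> nij /ord_inj.
exists pi2; split.
- apply/nc_matchingP; split=> [i | i j nji].
    have [->|/eqP nip] := eqVneq i p; first by rewrite pi2p pi2q.
    have [->|/eqP niq] := eqVneq i q; first by rewrite pi2q pi2p.
    by rewrite (pi2E i) // pi2E ?inv //; [apply: nep | apply: neq].
  have [Ei|/eqP nip] := eqVneq i p.
    rewrite Ei pi2p in nji *; have [->|/eqP njq] := eqVneq j q; first by rewrite ltnn.
    rewrite pi2E // => lt_j; rewrite pij // lt_j andbT lt0n.
    by apply/eqP => /cdist_eq0 Ej; apply: nji.
  have [Ei|/eqP niq] := eqVneq i q.
    rewrite Ei pi2q in nji *; have [->|/eqP njp] := eqVneq j p; first by rewrite ltnn.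
    rewrite pi2E // => lt_j.
    have [Ej | /eqP nj] := eqVneq (pi j) j; first by rewrite Ej.
    have := outside (pi j) (nep _ njp) (neq _ nji); rewrite inv => /(_ (nesym nj)).
    by have := dne _ _ npq'; move: lt_j; cdist_facts p q; cdist_facts q p; cdist_facts p (pi j); cdist_facts q (pi j); clear; lia.
  rewrite (pi2E i) // => lt_j.
  have [Ei | /eqP ni] := eqVneq (pi i) i; first by move: lt_j; rewrite Ei; cdist_facts i i; lia.
  have out_i := outside i nip niq ni.
  have := outside (pi i) (nep _ nip) (neq _ niq); rewrite inv => /(_ (nesym ni)) out_pi.
  have [Ej|/eqP njp] := eqVneq j p.
    rewrite Ej pi2p; rewrite Ej in lt_j; move: out_i out_pi lt_j.
    by cdist_facts p q; cdist_facts p i; cdist_facts p (pi i); cdist_facts i p; cdist_facts i q; cdist_facts i (pi i); clear; lia.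
  have [Ej|/eqP njq] := eqVneq j q.
    rewrite Ej pi2q; rewrite Ej in lt_j; move: out_i out_pi lt_j.
    by cdist_facts p q; cdist_facts p i; cdist_facts p (pi i); cdist_facts i p; cdist_facts i q; cdist_facts i (pi i); clear; lia.
  by rewrite pi2E //; apply: nc.
- move=> i; have [->|/eqP nip] := eqVneq i p; first by rewrite pi2p eq_sym npq pU.
  have [->|/eqP niq] := eqVneq i q; first by rewrite pi2q npq qD orbT.
  by rewrite pi2E // mv !inE; move/eqP: nip => ->; move/eqP: niq => ->.
- move=> t tD; have [->|/eqP ntq] := eqVneq t q; first by rewrite pi2q.
  have ntp : t <> p by move=> Et; rewrite Et (negbTE pD) in tD.
  rewrite pi2E //; have := DU t; rewrite !inE => H.
  by have /andP [] : (pi t != p) && (pi t \in U) by apply: H; rewrite tD andbT; apply/eqP.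
move=> t j tD; have [->|/eqP ntq] := eqVneq t q.
  rewrite pi2q => jpq; have /clos /andP [/negbTE -> /negbTE ->] // : 0 < d p j < d p q.
  by move: jpq; cdist_facts p q; cdist_facts p j; cdist_facts j q; clear; lia.
have ntp : t <> p by move=> Et; rewrite Et (negbTE pD) in tD.
have tD' : t \in D :\ q by rewrite !inE tD andbT; apply/eqP.
rewrite (pi2E t) // => lt_j.
have nt : pi t <> t by apply/eqP; rewrite mv tD' orbT.
have out_t := outside t ntp ntq nt.
have [->|/eqP njp] := eqVneq j p.
  rewrite pi2p qD (negbTE pD); split=> // _; split=> //; move: out_t.
  by have := dne _ _ ntp; have := dne _ _ ntq; have := dne _ _ npq'; cdist_facts p q; cdist_facts p t; cdist_facts q t; clear; lia.
have [->|/eqP njq] := eqVneq j q.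
  rewrite pi2q qD (negbTE qU); split=> // _; move: out_t.
  by have := dne _ _ ntp; have := dne _ _ ntq; have := dne _ _ npq'; cdist_facts p q; cdist_facts p t; cdist_facts q t; clear; lia.
have [clU clD] := cl t j tD' lt_j.
rewrite pi2E //; split=> jX.
  have [|] := clU; first by rewrite !inE jX andbT; apply/eqP.
  by rewrite !inE => /andP [_ ->].
by apply: clD; rewrite !inE jX andbT; apply/eqP.
Qed.

End Matching.

(** * Coloured matchings and ballot pairs *)

Definition rotperm n : {perm 'I_n} := perm (@ordS_inj n).

(** Rotation of a coloured matching; the set holds the unmatched points of the first colour. *)
Definition rotmatch n (x : {perm 'I_n} * {set 'I_n}) : {perm 'I_n} * {set 'I_n} :=
  ((x.1 ^ rotperm n)%g, rotset x.2).

(** The points of the first colour lie in both columns, an arc contributes one box to each. *)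
Definition match_set n k : {set {perm 'I_n} * {set 'I_n}} :=
  [set x : {perm 'I_n} * {set 'I_n} |
    [&& nc_matching x.1, [forall i in x.2, x.1 i == i]
             & 2 * #|x.2| + #|[set i | x.1 i != i]| == 2 * k]].

Section Words.
Variable n : nat.
Implicit Types (pi : {perm 'I_n}) (i j p q r : 'I_n) (t : nat) (U D A B C : {set 'I_n}).

Local Notation d := (cdist n).

Lemma rotmatch_inj : injective (@rotmatch n).
Proof. by case=> pi C [pi' C'] [/conjg_inj -> /rotset_inj ->]. Qed.

Lemma conj_rotperm pi i : (pi ^ rotperm n)%g (ordS i) = ordS (pi i).
Proof. by rewrite -[ordS i](permE (@ordS_inj n)) permJ permE. Qed.

Lemma iter_rotmatch s pi C :
  iter s (@rotmatch n) (pi, C) = ((pi ^ (rotperm n ^+ s))%g, iter s (@rotset n) C).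
Proof.
elim: s => [|s IHs]; first by rewrite conjg1.
by rewrite !iterS IHs /rotmatch /= expgSr conjgM.
Qed.

Lemma rotperm_exp s i : (rotperm n ^+ s)%g i = iter s (@ordS n) i.
Proof. by elim: s => [|s IHs]; rewrite ?expg0 ?perm1 // expgSr permM IHs permE. Qed.

Lemma iter_rotmatch_full x : iter n (@rotmatch n) x = x.
Proof.
case: x => pi C; rewrite iter_rotmatch iter_rotset_full.
suff -> : (rotperm n ^+ n = 1)%g by rewrite conjg1.
by apply/permP => i; rewrite rotperm_exp iter_ordS_full perm1.
Qed.

Lemma nc_matching_rot pi : nc_matching pi -> nc_matching (pi ^ rotperm n)%g.
Proof.
case/nc_matchingP => inv nc; apply/nc_matchingP; split=> [i|i j].
  by rewrite -(ord_predK i) !conj_rotperm inv.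
rewrite -(ord_predK i) -(ord_predK j) !conj_rotperm !cdist_ordS => nji; apply: nc.
by move=> E; apply: nji; rewrite E.
Qed.

Lemma rotmatch_stable k x : x \in match_set n k -> rotmatch x \in match_set n k.
Proof.
case: x => pi C; rewrite !inE /= => /and3P [mpi /forall_inP fC sz].
rewrite nc_matching_rot //=; apply/andP; split.
  apply/forall_inP => i; rewrite -(ord_predK i) mem_rotset => /fC /eqP piE.
  by rewrite conj_rotperm piE.
rewrite card_rotset -(eqP sz) eqn_add2l; apply/eqP.
rewrite -(card_rotset [set i | pi i != i]); apply: eq_card => i.
by rewrite -(ord_predK i) mem_rotset !inE conj_rotperm (inj_eq (@ordS_inj n)).
Qed.

Lemma coherent_disj U D pi C : coherent U D pi -> {in C, forall i, pi i = i} ->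
  {in C, forall i, (i \notin U) && (i \notin D)}.
Proof.
by move=> [_ mv _ _] fC i /fC piE; have := mv i; rewrite piE eqxx -negb_or => <-.
Qed.

Lemma word_split U D C : [disjoint U & D] ->
    {in C, forall i, (i \notin U) && (i \notin D)} ->
  [/\ (U :|: C) :\: (D :|: C) = U, (D :|: C) :\: (U :|: C) = D
    & (U :|: C) :&: (D :|: C) = C].
Proof.
move=> dUD dC; split; apply/setP=> i; rewrite !inE;
  move: (disjointFr dUD (x := i)) (dC i);
  case: (i \in U); case: (i \in D); case: (i \in C) => //= H1 H2;
    first [by have := H1 isT | by have := H2 isT].
Qed.

(** The matching and the colours are recovered from the word: A and B determine
    the openers A - B, the closers B - A and the coloured points, and
    [coherent_inj] does the rest. *)
Lemma word_inj U D U' D' pi pi' C C' :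
    [disjoint U & D] -> [disjoint U' & D'] -> #|U| <= #|D| + 2 ->
    coherent U D pi -> coherent U' D' pi' ->
    {in C, forall i, pi i = i} -> {in C', forall i, pi' i = i} ->
    U :|: C = U' :|: C' -> D :|: C = D' :|: C' -> (pi, C) = (pi', C').
Proof.
move=> dUD dUD' cU coh coh' fC fC' EA EB.
have [EU ED EC] := word_split dUD (coherent_disj coh fC).
have [EU' ED' EC'] := word_split dUD' (coherent_disj coh' fC').
rewrite -EA -EB in EU' ED' EC'; rewrite EU in EU'; rewrite ED in ED'; rewrite EC in EC'.
by subst U' D' C'; rewrite (coherent_inj dUD cU coh coh').
Qed.

Lemma card_word U D C : {in C, forall i, (i \notin U) && (i \notin D)} ->
  #|U :|: C| = #|U| + #|C| /\ #|D :|: C| = #|D| + #|C|.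
Proof.
move=> dC; split; apply/eqP; rewrite (leq_card_setU _ C) disjoint_sym disjoint_subset.
  by apply/subsetP => i /dC /andP [].
by apply/subsetP => i /dC /andP [].
Qed.

Lemma card_moved U D pi : [disjoint U & D] -> coherent U D pi ->
  #|[set i | pi i != i]| = #|U| + #|D|.
Proof.
move=> dUD [_ mv _ _]; have /eqP <- : #|U :|: D| == #|U| + #|D| by rewrite leq_card_setU.
by apply: eq_card => i; rewrite !inE mv.
Qed.

(** The orientation of arcs obtained by cutting the circle before the point 0. *)
Definition linU pi := [set i : 'I_n | i < pi i].
Definition linD pi := [set i : 'I_n | pi i < i].

Lemma lin_disj pi : [disjoint linU pi & linD pi].
Proof. by rewrite disjoint_subset; apply/subsetP => i; rewrite !inE; lia. Qed.

Lemma lin_coherent pi : nc_matching pi -> coherent (linU pi) (linD pi) pi.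
Proof.
move=> mpi; case/nc_matchingP: (mpi) => inv nc; split=> // [i|q|q j]; rewrite !inE ?inv //.
  by rewrite -neq_ltn eq_sym.
move=> lt_q lt_j; have := nc (pi q) j; rewrite inv.
have nj : j <> pi q by move=> Ej; rewrite Ej ltnn andbF in lt_j.
have nj' : nat_of_ord j <> pi q by move/ord_inj.
move=> /(_ nj); move: nj' lt_q lt_j; clear.
cdist_facts j q; cdist_facts (pi q) q; cdist_facts (pi q) j; cdist_facts (pi q) (pi j); cdist_facts (pi j) q.
by move=> *; split; lia.
Qed.

Definition lin_word (x : {perm 'I_n} * {set 'I_n}) := (linU x.1 :|: x.2, linD x.1 :|: x.2).

Definition prefix_card A t := #|[set i : 'I_n in A | i < t]|.

Definition ballot (w : {set 'I_n} * {set 'I_n}) :=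
  [forall t : 'I_n.+1, prefix_card w.2 t <= prefix_card w.1 t].

(** A closer in a prefix is matched with an opener in the same prefix. *)
Lemma lin_prefix pi t : (forall i, pi (pi i) = i) ->
  prefix_card (linD pi) t <= prefix_card (linU pi) t.
Proof.
move=> inv; rewrite /prefix_card -(card_imset (mem [set _ in _ | _]) (@perm_inj _ pi)).
apply/subset_leq_card/subsetP => i /imsetP [j + ->]; rewrite !inE inv; lia.
Qed.

Lemma lin_card pi : nc_matching pi -> #|linU pi| = #|linD pi|.
Proof.
move=> mpi; rewrite (card_leftover (lin_disj pi) (lin_coherent mpi)).
rewrite [leftover _ _](_ : _ = set0) ?cards0 ?addn0 //.
case/nc_matchingP: mpi => inv _.
by apply/setP=> i; rewrite !inE inv; lia.
Qed.

Lemma prefix_cardU A C t : [disjoint A & C] ->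
  prefix_card (A :|: C) t = prefix_card A t + prefix_card C t.
Proof.
move=> dAC; rewrite /prefix_card; apply/eqP.
have -> : [set i : 'I_n in A :|: C | i < t] = [set i : 'I_n in A | i < t] :|: [set i : 'I_n in C | i < t].
  by apply/setP=> i; rewrite !inE andb_orl.
rewrite leq_card_setU; apply: disjointW dAC; apply/subsetP => i; rewrite inE => /andP [] //.
Qed.

Lemma prefix_card_word A B t :
  (prefix_card B t <= prefix_card A t) = (prefix_card (B :\: A) t <= prefix_card (A :\: B) t).
Proof.
have split_card A' B' : prefix_card A' t = prefix_card (A' :&: B') t + prefix_card (A' :\: B') t.
  rewrite -[in LHS](setID A' B') prefix_cardU // -setI_eq0; apply/eqP/setP=> i.
  by rewrite !inE; case: (i \in A'); case: (i \in B').
by rewrite (split_card A B) (split_card B A) setIC leq_add2l.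
Qed.

Definition ballot_set k :=
  [set w : {set 'I_n} * {set 'I_n} | [&& #|w.1| == k, #|w.2| == k & ballot w]].

Lemma lin_word_inj k : {in match_set n k &, injective lin_word}.
Proof.
move=> [pi C] [pi' C']; rewrite !inE /= => /and3P [mpi /forall_inP fC _] /and3P [mpi' /forall_inP fC' _].
case=> EA EB; apply: (word_inj (lin_disj pi) (lin_disj pi')) EA EB.
- by rewrite lin_card // leq_addr.
- exact: lin_coherent.
- exact: lin_coherent.
- by move=> i /fC /eqP.
by move=> i /fC' /eqP.
Qed.

Lemma lin_word_ballot k x : x \in match_set n k -> lin_word x \in ballot_set k.
Proof.
case: x => pi C; rewrite !inE /= => /and3P [mpi /forall_inP fC /eqP sz].
have coh := lin_coherent mpi.
have fC' : {in C, forall i, pi i = i} by move=> i /fC /eqP.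
have dC := coherent_disj coh fC'.
have [EU ED EC] := word_split (lin_disj pi) dC.
have [-> ->] := card_word dC.
have cm := card_moved (lin_disj pi) coh; have cl := lin_card mpi.
rewrite cm cl in sz; rewrite cl.
have -> : #|linD pi| + #|C| == k by apply/eqP; move: sz; clear; unfold reverse_coercion; simpl; lia.
apply/forallP => t; rewrite prefix_card_word /= ED EU lin_prefix //.
by case/nc_matchingP: mpi.
Qed.

Lemma prefix_cardS A i :
  prefix_card A i.+1 = prefix_card A i + (i \in A).
Proof.
rewrite /prefix_card (cardsD1 i) !inE ltnS leqnn andbT addnC; congr (_ + _).
apply: eq_card => j; rewrite !inE ltnS [in RHS]ltn_neqAle.
by rewrite andbCA (inj_eq (@ord_inj n)).
Qed.

(** The arc of an opener cannot wrap around 0: all openers before its end q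
    would be closed before q, so the prefix up to q would contain more closers
    than openers. *)
Lemma ballot_coherent_lin U D pi : [disjoint U & D] -> #|U| = #|D| ->
    coherent U D pi -> (forall t, t <= n -> prefix_card D t <= prefix_card U t) ->
  linU pi = U /\ linD pi = D.
Proof.
move=> dUD cUD coh bal; case: (coh) => /nc_matchingP [inv nc] mv DU cl.
have UD i : i \in U -> pi i \in D.
  move=> iU; have := card_leftover dUD coh; rewrite cUD => /eqP.
  rewrite -[X in X == _]addn0 eqn_add2l eq_sym cards_eq0 => /eqP/setP/(_ i).
  rewrite !inE iU /= => piU; have := mv (pi i); rewrite piU /= => <-.
  by rewrite inv eq_sym mv iU.
have ltU i : i \in U -> i < pi i.
  move=> iU; rewrite ltnNge leq_eqVlt; apply/negP => /orP [/eqP /ord_inj E|lt_qi].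
    by have := mv i; rewrite E eqxx iU.
  have := bal (pi i).+1 (ltn_ord _); rewrite !prefix_cardS UD //.
  rewrite [pi i \in U](disjointFl dUD (UD i iU)) addn0 addn1 ltnNge => /negP; apply.
  rewrite /prefix_card -(card_imset (mem [set _ in U | _]) (@perm_inj _ pi)).
  apply/subset_leq_card/subsetP => _ /imsetP [j + ->]; rewrite !inE => /andP [jU lt_j].
  have arc_j : 0 < d j (pi i) < d (pi (pi i)) (pi i).
    by rewrite inv; move: lt_qi lt_j; cdist_facts j (pi i); cdist_facts i (pi i); lia.
  have [/(_ jU) [-> lt_pj] _] := cl (pi i) j (UD i iU) arc_j.
  have npj : nat_of_ord (pi j) <> pi i by move/ord_inj/perm_inj => Ej; rewrite Ej in lt_j; lia.
  by rewrite /=; move: npj lt_pj lt_j; cdist_facts (pi j) (pi i); cdist_facts j (pi i); lia.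
have gtD i : i \in D -> pi i < i by move/DU/ltU; rewrite inv.
split; apply/setP=> i; rewrite inE.
  apply/idP/idP => [lt_i | /ltU //]; have := mv i.
  rewrite neq_ltn lt_i orbT => /esym/orP [//|/gtD]; lia.
apply/idP/idP => [lt_i | /gtD //]; have := mv i.
rewrite neq_ltn lt_i => /esym/orP [/ltU|//]; lia.
Qed.

Lemma word_in_match_set U D pi C k : [disjoint U & D] -> coherent U D pi ->
  {in C, forall i, (i \notin U) && (i \notin D)} -> #|U :|: C| + #|D :|: C| = 2 * k ->
  (pi, C) \in match_set n k.
Proof.
move=> dUD coh dC sz; rewrite inE /= (coherent_matching coh).
rewrite (card_moved dUD coh); have [E1 E2] := card_word dC.
rewrite /=; apply/andP; split; last by apply/eqP; move: sz E1 E2; clear; unfold reverse_coercion; simpl; lia.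
apply/forall_inP => i /dC; rewrite -negb_or; case: coh => _ <- _ _.
by rewrite negbK.
Qed.

Lemma diff_disj A B : [disjoint A :\: B & B :\: A].
Proof.
by rewrite -setI_eq0; apply/eqP/setP=> i; rewrite !inE; case: (i \in A); case: (i \in B).
Qed.

Lemma diff_capE A B : A :\: B :|: A :&: B = A.
Proof. by rewrite setUC setID. Qed.

Lemma diff_capC A B : {in A :&: B, forall i, (i \notin A :\: B) && (i \notin B :\: A)}.
Proof. by move=> i; rewrite !inE => /andP [-> ->]. Qed.

Lemma lin_word_surj k w : w \in ballot_set k ->
  exists2 x, x \in match_set n k & lin_word x = w.
Proof.
case: w => A B; rewrite inE /= => /and3P [/eqP cA /eqP cB /forallP bal].
have cUD : #|A :\: B| = #|B :\: A|.
  by have := cardsID B A; have := cardsID A B; rewrite cA cB setIC; clear; unfold reverse_coercion; simpl; lia.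
have [pi coh] := exists_coherent (diff_disj A B) (or_introl cUD).
have [EU ED] : linU pi = A :\: B /\ linD pi = B :\: A.
  apply: (ballot_coherent_lin (diff_disj A B) cUD coh) => t le_tn.
  by have := bal (Ordinal (le_tn : t < n.+1)); rewrite prefix_card_word.
exists (pi, A :&: B).
  apply: (word_in_match_set (diff_disj A B) coh (@diff_capC A B)).
  by rewrite diff_capE [A :&: B]setIC diff_capE cA cB mul2n addnn.
by rewrite /lin_word /= EU ED diff_capE [A :&: B]setIC diff_capE.
Qed.

End Words.

(** * Matchings fixed by a rotation *)

Section Fixed.
Variable n : nat.
Implicit Types (pi : {perm 'I_n}) (i j p q r : 'I_n) (U D A B C : {set 'I_n}).

Local Notation d := (cdist n).

Lemma cdist_iter s i j : d (iter s (@ordS n) i) (iter s (@ordS n) j) = d i j.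
Proof. by elim: s => //= s IHs; rewrite cdist_ordS. Qed.

Lemma coherent_rot U D pi : coherent U D pi ->
  coherent (rotset U) (rotset D) (pi ^ rotperm n)%g.
Proof.
case=> mpi mv DU cl; split=> [|i|q|q j]; first exact: nc_matching_rot.
- by rewrite -(ord_predK i) conj_rotperm (inj_eq (@ordS_inj n)) !mem_rotset.
- by rewrite -(ord_predK q) conj_rotperm !mem_rotset; apply: DU.
by rewrite -(ord_predK q) -(ord_predK j) !conj_rotperm !mem_rotset !cdist_ordS; apply: cl.
Qed.

Lemma coherent_iter s U D pi : coherent U D pi ->
  coherent (iter s (@rotset n) U) (iter s (@rotset n) D) (pi ^ (rotperm n ^+ s))%g.
Proof.
move=> coh; elim: s => [|s IHs]; first by rewrite conjg1.
by rewrite !iterS expgSr conjgM; apply: coherent_rot.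
Qed.

Lemma periodic_perm s pi :
  reflect (forall i, pi (iter s (@ordS n) i) = iter s (@ordS n) (pi i))
          ((pi ^ (rotperm n ^+ s))%g == pi).
Proof.
apply: (iffP eqP) => [E i | E].
  by rewrite -!rotperm_exp -{1}E permJ.
apply/permP => i; have [j ->] := iter_ordS_surj s i.
by rewrite E -!rotperm_exp permJ.
Qed.

(** Every arc is oriented along its shorter side.  A diameter has two openers, and
    this is the only case in which openers and closers are not equinumerous. *)
Definition shortU pi := [set i : 'I_n | (pi i != i) && (2 * d i (pi i) <= n)].
Definition shortD pi := [set i : 'I_n | n < 2 * d i (pi i)].

Lemma short_disj pi : [disjoint shortU pi & shortD pi].
Proof. by rewrite disjoint_subset; apply/subsetP => i; rewrite !inE; lia. Qed.

(** The arcs below a short arc are shorter still, so they are oriented alike. *)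
Lemma short_coherent pi : nc_matching pi -> coherent (shortU pi) (shortD pi) pi.
Proof.
move=> mpi; case/nc_matchingP: (mpi) => inv nc; split=> // [i|q|q j]; rewrite !inE ?inv.
- have [-> | ni] := eqVneq (pi i) i; first by cdist_facts i i; lia.
  by rewrite /=; lia.
- move=> lt_q; have ne : pi q != q by apply: contraTneq lt_q => ->; cdist_facts q q; lia.
  rewrite eq_sym ne; move: lt_q; move/eqP: ne => ne.
  have : nat_of_ord (pi q) <> q by move/ord_inj.
  by cdist_facts q (pi q); cdist_facts (pi q) q; lia.
move=> lt_q lt_j; have := nc (pi q) j; rewrite inv.
have nj : j <> pi q by move=> Ej; rewrite Ej ltnn andbF in lt_j.
have nj' : nat_of_ord j <> pi q by move/ord_inj.
have njq : nat_of_ord j <> q by move: lt_j; cdist_facts j q; lia.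
have npjq : nat_of_ord (pi j) <> q.
  by move/ord_inj => Ej; apply: nj; rewrite -Ej inv.
move=> /(_ nj) H; have {}H : d (pi q) (pi j) < d (pi q) q.
  by apply: H; move: nj' lt_j; cdist_facts (pi q) j; cdist_facts j q; cdist_facts (pi q) q; lia.
have npjr : nat_of_ord (pi j) <> pi q by move/ord_inj/perm_inj/(congr1 val).
have qr : 2 * d (pi q) q < n.
  by move: lt_q lt_j; cdist_facts j q; cdist_facts q (pi q); cdist_facts (pi q) q; lia.
have far : d (pi q) j < d (pi q) q by move: nj' lt_j; cdist_facts (pi q) j; cdist_facts j q; cdist_facts (pi q) q; lia.
split=> [/andP [/eqP npj lt_pj] | lt_pj].
  have npj' : nat_of_ord (pi j) <> j by move/ord_inj.
  by move: H far qr lt_pj npj' nj' njq npjq npjr; clear;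
     cdist_facts (pi q) (pi j); cdist_facts (pi q) j; cdist_facts (pi q) q; cdist_facts j (pi j); cdist_facts (pi j) j; cdist_facts (pi j) q; cdist_facts j q; lia.
have npj' : nat_of_ord (pi j) <> j by move=> /ord_inj E; move: lt_pj; rewrite E; cdist_facts j j; lia.
by move: H far qr lt_pj npj' nj' njq npjq npjr; clear;
   cdist_facts (pi q) (pi j); cdist_facts (pi q) j; cdist_facts (pi q) q; cdist_facts j (pi j); cdist_facts (pi j) q; cdist_facts j q; lia.
Qed.

(** These are the ends of diameters, and two diameters would cross. *)
Lemma leftover_short pi : nc_matching pi ->
  #|leftover (shortU pi) pi| = 0 \/ #|leftover (shortU pi) pi| = 2.
Proof.
move=> mpi; case/nc_matchingP: (mpi) => inv nc.
have [-> | [i iL]] := set_0Vmem (leftover (shortU pi) pi); first by left; rewrite cards0.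
right.
have diam j : j \in leftover (shortU pi) pi -> pi j != j /\ 2 * d j (pi j) = n.
  rewrite !inE inv => /andP [/andP [nj le1] /andP [_ le2]]; split=> //.
  move: le1 le2; have : nat_of_ord (pi j) <> j by move/ord_inj; apply/eqP.
  by cdist_facts j (pi j); cdist_facts (pi j) j; lia.
have [ni di] := diam _ iL.
suff -> : leftover (shortU pi) pi = [set i; pi i] by rewrite cards2 eq_sym ni.
apply/setP=> j; rewrite in_set2; apply/idP/orP => [jL | jE]; last first.
  by move: iL; case: jE => /eqP ->; rewrite !inE inv // => /andP [-> ->].
have [nj dj] := diam _ jL.
have [_|/eqP nji] := eqVneq j i; first by left.
have [_|/eqP njpi] := eqVneq j (pi i); first by right.
have nji' : nat_of_ord j <> i by move/ord_inj.
have njpi' : nat_of_ord j <> pi i by move/ord_inj.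
have npji' : nat_of_ord (pi j) <> i by move=> /ord_inj E; apply: njpi; rewrite -E inv.
have npjpi' : nat_of_ord (pi j) <> pi i by move=> /ord_inj/perm_inj/(congr1 val).
exfalso; have := nc i j nji; have := nc (pi i) j njpi; rewrite inv.
move: di dj nji' njpi' npji' npjpi'; clear.
by cdist_facts i j; cdist_facts i (pi i); cdist_facts i (pi j); cdist_facts (pi i) j; cdist_facts (pi i) i; cdist_facts (pi i) (pi j); cdist_facts j (pi j); lia.
Qed.

Lemma short_card pi : nc_matching pi ->
  #|shortU pi| = #|shortD pi| \/ #|shortU pi| = #|shortD pi| + 2.
Proof.
move=> mpi; rewrite (card_leftover (short_disj pi) (short_coherent mpi)).
by case: (leftover_short mpi) => ->; [left; rewrite addn0 | right].
Qed.

Definition short_word (x : {perm 'I_n} * {set 'I_n}) :=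
  (shortU x.1 :|: x.2, shortD x.1 :|: x.2).

Definition periodic_words s k : {set {set 'I_n} * {set 'I_n}} :=
  [set w | [&& iter s (@rotset n) w.1 == w.1, iter s (@rotset n) w.2 == w.2,
     #|w.1| + #|w.2| == 2 * k & (#|w.1| == #|w.2|) || (#|w.1| == #|w.2| + 2)]].

Lemma short_word_inj k : {in match_set n k &, injective short_word}.
Proof.
move=> [pi C] [pi' C']; rewrite !inE /= => /and3P [mpi /forall_inP fC _] /and3P [mpi' /forall_inP fC' _].
case=> EA EB; apply: (word_inj (short_disj pi) (short_disj pi')) EA EB.
- by case: (short_card mpi) => ->; rewrite ?leq_addr.
- exact: short_coherent.
- exact: short_coherent.
- by move=> i /fC /eqP.
by move=> i /fC' /eqP.
Qed.

Lemma short_word_periodic s k x : x \in match_set n k ->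
  iter s (@rotmatch n) x = x -> short_word x \in periodic_words s k.
Proof.
case: x => pi C; rewrite !inE /= => /and3P [mpi /forall_inP fC /eqP sz].
rewrite iter_rotmatch => -[/eqP/periodic_perm Epi /eqP/periodicP EC].
have coh := short_coherent mpi.
have fC' : {in C, forall i, pi i = i} by move=> i /fC /eqP.
have dC := coherent_disj coh fC'.
have [E1 E2] := card_word dC.
have cm := card_moved (short_disj pi) coh.
rewrite cm in sz; rewrite {1}E1 {1}E2.
apply/and4P; split.
- by apply/periodicP => i; rewrite !inE Epi cdist_iter (inj_eq (@iter_ordS_inj n s)) EC.
- by apply/periodicP => i; rewrite !inE Epi cdist_iter EC.
- by apply/eqP; move: sz; clear; unfold reverse_coercion; simpl; lia.
rewrite E1 E2; have := short_card mpi.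
by case=> ->; rewrite ?eqxx // -!addnA [2 + _]addnC eqxx orbT.
Qed.

(** By uniqueness the matching of a periodic word is periodic.  An opener r and
    its translate r + s are both openers, so the arc of r ends before r + s and
    is shorter than n / 2.  If two openers are matched with each other, the
    rotation by s must exchange them, and their arc is a diameter. *)
Lemma periodic_coherent_short s U D pi : 0 < s -> s + s <= n ->
    [disjoint U & D] -> #|U| <= #|D| + 2 ->
    iter s (@rotset n) U == U -> iter s (@rotset n) D == D -> coherent U D pi ->
  [/\ (pi ^ (rotperm n ^+ s))%g = pi, shortU pi = U & shortD pi = D].
Proof.
move=> s0 s2 dUD leUD perU perD coh.
have Epi : (pi ^ (rotperm n ^+ s))%g = pi.
  by have := coherent_iter s coh; rewrite (eqP perU) (eqP perD) => coh'; apply: coherent_inj coh' coh.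
have piS := elimT (periodic_perm s pi) (introT eqP Epi).
case: (coh) => /nc_matchingP [inv nc] mv DU cl.
have sft i : (i + s < n /\ iter s (@ordS n) i = i + s :> nat)
          \/ (n <= i + s /\ iter s (@ordS n) i + n = i + s :> nat).
  rewrite iter_ordS; have := ltn_ord i; case: (ltnP (i + s) n) => H lt_in; [left | right]; split=> //.
    by rewrite modn_small.
  by rewrite -{1}(subnK H) modnDr modn_small ?subnK //; lia.
have shortarc q : q \in D -> d (pi q) q < s.
  move=> qD; set r := pi q; set r' := iter s (@ordS n) r; set q' := iter s (@ordS n) q.
  have r'U : r' \in U by rewrite (periodicP _ _ perU) DU.
  have nr'q : r' <> q by move=> E; rewrite E (disjointFl dUD qD) in r'U.
  have nr'q' : nat_of_ord r' <> q by move/ord_inj.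
  rewrite ltnNge; apply/negP => le_s.
  have [|/(_ r'U)] := cl q r' qD.
    by move: le_s nr'q'; case: (sft r) => -[]; rewrite -/r -/r'; cdist_facts r' q; cdist_facts r q; lia.
  rewrite piS inv -/q' => -[_ + _].
  by move: le_s nr'q'; case: (sft r) => -[]; case: (sft q) => -[]; rewrite -/r' -/q';
     cdist_facts r' q; cdist_facts r q; cdist_facts q' q; lia.
have EU i : i \in U -> i \in shortU pi.
  move=> iU; rewrite inE mv iU /=.
  have [piU | npiU] := boolP (pi i \in U); last first.
    have piD : pi i \in D.
      by have := mv (pi i); rewrite inv eq_sym mv iU (negbTE npiU) /= => <-.
    by have := shortarc _ piD; rewrite inv; lia.
  have iL : i \in leftover U pi by rewrite inE iU.
  have L2 : #|leftover U pi| <= 2.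
    by rewrite -(leq_add2l #|D|) -(card_leftover dUD coh).
  have ni : pi i != i by rewrite mv iU.
  have DL : leftover U pi = [set i; pi i].
    apply/esym/eqP; rewrite eqEcard cards2 eq_sym ni L2 andbT.
    by apply/subsetP => j; rewrite !inE => /orP [] /eqP ->; rewrite ?inv iU piU.
  have : iter s (@ordS n) i \in leftover U pi.
    by rewrite inE piS !(periodicP _ _ perU) iU.
  have nsi : nat_of_ord (iter s (@ordS n) i) <> i by have := ltn_ord i; case: (sft i) => -[]; lia.
  rewrite DL in_set2 => /orP [/eqP /(congr1 val) /= // | /eqP <-].
  by case: (sft i) => -[]; cdist_facts i (iter s (@ordS n) i); lia.
have ED i : i \in D -> i \in shortD pi.
  move=> iD; rewrite inE; have := shortarc i iD.
  have : nat_of_ord (pi i) <> i by apply/eqP; rewrite (inj_eq (@ord_inj n)) mv iD orbT.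
  by cdist_facts i (pi i); cdist_facts (pi i) i; lia.
have {}EU : shortU pi = U.
  apply/setP=> i; apply/idP/idP => [iS | /EU //].
  have := mv i; move: (iS); rewrite inE => /andP [-> _] /esym/orP [//|/ED iD].
  by rewrite (disjointFl (short_disj pi) iD) in iS.
have {}ED : shortD pi = D.
  apply/setP=> i; apply/idP/idP => [iS | /ED //].
  have ni : pi i != i by apply: contraTneq iS => E; rewrite inE E; cdist_facts i i; lia.
  have := mv i; rewrite ni -EU => /esym/orP [iD|//].
  by rewrite (disjointFr (short_disj pi) iD) in iS.
by [].
Qed.

Lemma short_word_surj s k w : 0 < s -> s + s <= n -> w \in periodic_words s k ->
  exists2 x, (x \in match_set n k) && (iter s (@rotmatch n) x == x) & short_word x = w.
Proof.
case: w => A B s0 s2; rewrite inE /= => /and4P [perA perB /eqP sz cAB].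
have perU : iter s (@rotset n) (A :\: B) == A :\: B.
  by apply/periodicP => i; rewrite !inE !(periodicP _ _ _).
have perD : iter s (@rotset n) (B :\: A) == B :\: A.
  by apply/periodicP => i; rewrite !inE !(periodicP _ _ _).
have cUD : #|A :\: B| = #|B :\: A| \/ #|A :\: B| = #|B :\: A| + 2.
  have := cardsID B A; have := cardsID A B; rewrite setIC => E1 E2.
  by case/orP: cAB => /eqP; rewrite -E1 -E2 -?addnA => /addnI; [left | right].
have dUD := diff_disj A B.
have leUD : #|A :\: B| <= #|B :\: A| + 2 by case: cUD => ->; rewrite ?leq_addr.
have [pi coh] := exists_coherent dUD cUD.
have [Epi EU ED] := periodic_coherent_short s0 s2 dUD leUD perU perD coh.
exists (pi, A :&: B); last first.
  by rewrite /short_word /= EU ED diff_capE [A :&: B]setIC diff_capE.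
apply/andP; split.
  apply: (word_in_match_set dUD coh (@diff_capC n A B)).
  by rewrite diff_capE [A :&: B]setIC diff_capE.
rewrite iter_rotmatch Epi; apply/eqP; congr (_, _); apply/eqP/periodicP => i.
by rewrite !inE (periodicP _ _ perA) (periodicP _ _ perB).
Qed.

Lemma card_fixed_short s k : 0 < s -> s + s <= n ->
  #|[set x in match_set n k | iter s (@rotmatch n) x == x]| = #|periodic_words s k|.
Proof.
move=> s0 s2; rewrite -(@card_in_imset _ _ short_word).
  apply: eq_card => w; apply/imsetP/idP => [[x] | /(short_word_surj s0 s2) [x xF <-]].
    by rewrite inE => /andP [xM /eqP xF] ->; apply: short_word_periodic.
  by exists x; rewrite // inE.
move=> x y; rewrite !inE => /andP [xM _] /andP [yM _].
by apply: (@short_word_inj k); rewrite inE.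
Qed.

(** The sizes are (k, k) or (k + 1, k - 1), since they add up to 2 k. *)
Lemma card_periodic_words s k : 0 < n -> s %| n -> 0 < k ->
  #|periodic_words s k| =
    sparse_bin (n %/ s) n k ^ 2 + sparse_bin (n %/ s) n k.+1 * sparse_bin (n %/ s) n k.-1.
Proof.
move=> n0 sn k0.
pose P (a : nat) := [set A : {set 'I_n} | (iter s (@rotset n) A == A) && (#|A| == a)].
have -> : periodic_words s k = setX (P k) (P k) :|: setX (P k.+1) (P k.-1).
  apply/setP=> -[A B]; rewrite !inE /=.
  case: (iter s _ A == A); case: (iter s _ B == B); rewrite ?andbF //=.
  by apply/idP/idP; lia.
rewrite cardsU [X in _ - X](_ : _ = 0) ?subn0; last first.
  apply: eq_card0 => -[A B]; rewrite !inE /=; apply/negP.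
  by case/andP => /andP [/andP [_ /eqP ->] _] /andP [/andP [_]]; lia.
by rewrite !cardsX !card_periodic // mulnn.
Qed.

End Fixed.

(** * Counting ballot pairs *)

Section ExtendSet.
Variable n : nat.
Implicit Types (A : {set 'I_n}) (x : bool).

(** Adds a last point to the ground set, which is put into the subset when x holds. *)
Definition extend_set x A : {set 'I_n.+1} :=
  [set i | if unlift ord_max i is Some j then j \in A else x].

Lemma extend_set_lift x A j : (lift ord_max j \in extend_set x A) = (j \in A).
Proof. by rewrite inE liftK. Qed.

Lemma extend_set_max x A : (ord_max \in extend_set x A) = x.
Proof. by rewrite inE unlift_none. Qed.

Lemma extend_setK (A' : {set 'I_n.+1}) :
  extend_set (ord_max \in A') [set j | lift ord_max j \in A'] = A'.
Proof.
apply/setP=> i; case: (unliftP ord_max i) => [j ->|->]; last by rewrite extend_set_max.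
by rewrite extend_set_lift inE.
Qed.

Lemma prefix_extend x A t : t <= n -> prefix_card (extend_set x A) t = prefix_card A t.
Proof.
move=> le_tn; rewrite /prefix_card -[RHS](card_imset (mem [set _ in A | _]) (@lift_inj _ ord_max)).
apply: eq_card => i; rewrite inE; apply/andP/imsetP => [[]|[j + ->]]; last first.
  by rewrite !inE liftK lift_max => /andP.
case: (unliftP ord_max i) => [j ->|->]; last by move=> _; rewrite ltnNge le_tn.
by rewrite extend_set_lift lift_max => jA lt_j; exists j; rewrite // !inE jA.
Qed.

End ExtendSet.

Lemma prefix_full n (A : {set 'I_n}) : prefix_card A n = #|A|.
Proof. by apply: eq_card => i; rewrite inE ltn_ord andbT. Qed.

Lemma card_extend n x (A : {set 'I_n}) : #|extend_set x A| = #|A| + x.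
Proof.
have := prefix_cardS (extend_set x A) ord_max.
by rewrite prefix_full extend_set_max /= prefix_extend // prefix_full.
Qed.

Lemma ballot_extend n x y (A B : {set 'I_n}) :
  ballot (extend_set x A, extend_set y B) = (#|B| + y <= #|A| + x) && ballot (A, B).
Proof.
apply/forallP/andP => /= [H | [H /forallP HAB] t].
  split; first by have := H ord_max; rewrite !prefix_full !card_extend.
  apply/forallP => t; have := H (widen_ord (leqnSn _) t).
  by rewrite /= !prefix_extend // -ltnS.
have := ltn_ord t; rewrite ltnS leq_eqVlt => /predU1P [-> | lt_t].
  by rewrite !prefix_full !card_extend.
by have := HAB (Ordinal lt_t); rewrite /= !prefix_extend.
Qed.

Definition ballot_num n a b :=
  #|[set w : {set 'I_n} * {set 'I_n} | [&& #|w.1| == a, #|w.2| == b & ballot w]]|.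

Lemma ballot_numS n a b : b <= a ->
  ballot_num n.+1 a b =
    \sum_(x : bool) \sum_(y : bool)
      #|[set w : {set 'I_n} * {set 'I_n} | [&& #|w.1| + x == a, #|w.2| + y == b & ballot w]]|.
Proof.
move=> le_ba; rewrite pair_big /=.
pose ext (p : (bool * bool) * ({set 'I_n} * {set 'I_n})) :=
  (extend_set p.1.1 p.2.1, extend_set p.1.2 p.2.2).
have ext_bij : bijective ext.
  exists (fun w : {set 'I_n.+1} * {set 'I_n.+1} =>
            ((ord_max \in w.1, ord_max \in w.2),
             ([set j : 'I_n | lift ord_max j \in w.1],
              [set j : 'I_n | lift ord_max j \in w.2]))).
    case=> [[x y] [A B]]; rewrite /ext /= !extend_set_max; congr ((_, _), (_, _)).
      by apply/setP=> j; rewrite inE extend_set_lift.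
    by apply/setP=> j; rewrite inE extend_set_lift.
  by case=> A B; rewrite /ext /= !extend_setK.
rewrite /ballot_num -sum1_card (reindex ext) /=; last by apply: onW_bij.
under [RHS]eq_bigr => q _ do rewrite -sum1_card.
rewrite pair_big_dep /=; apply: eq_bigl => -[[x y] [A B]].
rewrite !inE /= !card_extend ballot_extend.
by case: eqP => //= ->; case: eqP => //= ->; rewrite le_ba.
Qed.

Lemma ballot_num_gt n a b : a < b -> ballot_num n a b = 0.
Proof.
move=> lt_ab; apply: eq_card0 => -[A B]; rewrite !inE /=; apply/negP.
case/and3P => /eqP cA /eqP cB /forallP /(_ ord_max); rewrite /= !prefix_full cA cB.
by rewrite leqNgt lt_ab.
Qed.

(** Both sides satisfy the same recursion in n, and on the boundary b = a + 1
    the determinant vanishes as there is no ballot pair. *)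
Lemma ballot_num_det n a b : b <= a.+1 ->
  'C(n, a) * 'C(n, b) = ballot_num n a b
    + (if b is b'.+1 then 'C(n, a.+1) * 'C(n, b') else 0).
Proof.
elim: n a b => [|n IHn] a b.
  have -> : ballot_num 0 a b = (a == 0) && (b == 0).
    rewrite /ballot_num; set S := [set w | _].
    have emp (A : {set 'I_0}) : A = set0 by apply/setP=> -[].
    have -> : S = if (a == 0) && (b == 0) then [set (set0, set0)] else set0.
      apply/setP=> -[A B]; rewrite inE (emp A) (emp B) /= cards0 ![0 == _]eq_sym.
      have -> : @ballot 0 (set0, set0) by apply/forallP => t; rewrite /= leqnn.
      by rewrite andbT; case: ifP; rewrite inE ?eqxx.
    by case: ifP; rewrite ?cards1 ?cards0.
  by case: a b => [|a] [|[|b]] // le_ba; rewrite !bin0n.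
rewrite leq_eqVlt => /predU1P [-> | le_ba]; first by rewrite ballot_num_gt // mulnC.
rewrite ltnS in le_ba; rewrite ballot_numS // !big_bool /=.
have term00 : #|[set w : {set 'I_n} * {set 'I_n} | [&& #|w.1| + 0 == a, #|w.2| + 0 == b & ballot w]]|
    = ballot_num n a b by apply: eq_card => w; rewrite !inE !addn0.
have term10 : #|[set w : {set 'I_n} * {set 'I_n} | [&& #|w.1| + 1 == a, #|w.2| + 0 == b & ballot w]]|
    = if a is a'.+1 then ballot_num n a' b else 0.
  case: a {le_ba term00} => [|a]; first by apply: eq_card0 => w; rewrite !inE addn1.
  by apply: eq_card => w; rewrite !inE addn0 addn1 eqSS.
have term01 : #|[set w : {set 'I_n} * {set 'I_n} | [&& #|w.1| + 0 == a, #|w.2| + 1 == b & ballot w]]|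
    = if b is b'.+1 then ballot_num n a b' else 0.
  case: b {le_ba term00 term10} => [|b]; first by apply: eq_card0 => w; rewrite !inE addn1 andbF.
  by apply: eq_card => w; rewrite !inE addn0 addn1 eqSS.
have term11 : #|[set w : {set 'I_n} * {set 'I_n} | [&& #|w.1| + 1 == a, #|w.2| + 1 == b & ballot w]]|
    = if a is a'.+1 then if b is b'.+1 then ballot_num n a' b' else 0 else 0.
  case: a b {le_ba term00 term10 term01} => [|a] [|b];
    try by apply: eq_card0 => w; rewrite !inE !addn1 ?andbF.
  by apply: eq_card => w; rewrite !inE !addn1 !eqSS.
rewrite {}term00 {}term10 {}term01 {}term11.
case: a b le_ba => [|a] [|b] le_ba; rewrite ?bin0 ?binS //.
- by rewrite -(addn0 (ballot_num n 0 0)) -(IHn 0 0) // bin0.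
- by have := IHn a.+1 0 isT; have := IHn a 0 isT; rewrite !bin0; lia.
have H1 := IHn a.+1 b.+1 (leqW le_ba); have H2 := IHn a b.+1 le_ba.
have H3 := IHn a.+1 b (leqW (ltnW le_ba)); have H4 := IHn a b (ltnW le_ba).
case: b le_ba H1 H2 H3 H4 => [|b] le_ba; rewrite ?bin0 ?binS; lia.
Qed.

Lemma card_ballot_set n k :
  #|ballot_set n k| + (if k is k'.+1 then 'C(n, k.+1) * 'C(n, k') else 0) = 'C(n, k) ^ 2.
Proof. by rewrite -mulnn ballot_num_det. Qed.

(** * Bender-Knuth involutions on two columns *)

(** The cell of row r in the left column: [a0], [a1] tell whether i, i + 1 occur
    in that column and [p] is the row where i does or would occur; [b0], [b1]
    and [q] are the same data for the right column.  If the cell is free, the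
    entry prescribed by the free cells of its row occurs, after the exchange of
    letters, in the column and in row r. *)
Lemma bk_left_column (a0 a1 b0 b1 : bool) (p q r : nat) :
  (a0 && (p == r)) && ~~ a1 || (a1 && (p + a0 == r)) && ~~ a0 ->
  if 0 < ((a1 && (p + a0 == r)) && ~~ a0) + ((b1 && (q + b0 == r)) && ~~ b0)
  then (if [&& a0, ~~ a1, ~~ b0, b1 & p == q] then a0 else a1) && (p == r)
  else (if [&& a0, ~~ a1, ~~ b0, b1 & p == q] then a1 else a0)
       && (p + (if [&& a0, ~~ a1, ~~ b0, b1 & p == q] then a0 else a1) == r).
Proof.
case: a0; case: a1; case: b0; case: b1; rewrite ?addn0 ?addn1 ?andbF ?orbF //=;
  do 6?[case: eqP => //= ?]; lia.
Qed.
(** The same for the cell of row r in the right column. *)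
Lemma bk_right_column (a0 a1 b0 b1 : bool) (p q r : nat) :
  (b0 && (q == r)) && ~~ b1 || (b1 && (q + b0 == r)) && ~~ b0 ->
  if ((a0 && (p == r)) && ~~ a1 || (a1 && (p + a0 == r)) && ~~ a0)
     < ((a1 && (p + a0 == r)) && ~~ a0) + ((b1 && (q + b0 == r)) && ~~ b0)
  then (if [&& a0, ~~ a1, ~~ b0, b1 & p == q] then b0 else b1) && (q == r)
  else (if [&& a0, ~~ a1, ~~ b0, b1 & p == q] then b1 else b0)
       && (q + (if [&& a0, ~~ a1, ~~ b0, b1 & p == q] then b0 else b1) == r).
Proof.
case: a0; case: a1; case: b0; case: b1; rewrite ?addn0 ?addn1 ?andbF ?orbF //=;
  do 6?[case: eqP => //= ?]; lia.
Qed.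

Section TwoColumns.
Variable k : nat.
Local Notation lam := (nseq k 2).
Implicit Types (b : box lam) (T : box lam -> nat) (w : nat -> nat -> bool).

Lemma brow_lt b : brow b < k.
Proof. by apply: leq_trans (ltn_ord (tag b)) _; rewrite size_nseq. Qed.

Lemma bcol_lt b : bcol b < 2.
Proof. by apply: leq_trans (ltn_ord (tagged b)) _; rewrite nth_nseq; case: ifP. Qed.

Lemma box_exists r c : r < k -> c < 2 -> exists b, brow b = r /\ bcol b = c.
Proof.
move=> lt_rk lt_c2; have ltr : r < size lam by rewrite size_nseq.
have ltc : c < nth 0 lam (Ordinal ltr) by rewrite nth_nseq lt_rk.
by exists (Tagged (fun i : 'I_(size lam) => 'I_(nth 0 lam i)) (Ordinal ltc)).
Qed.

Lemma box_inj b b' : brow b = brow b' -> bcol b = bcol b' -> b = b'.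
Proof.
case: b b' => [i j] [i' j']; rewrite /brow /bcol /= => /ord_inj Ei; subst i'.
by move/ord_inj => ->.
Qed.

(** The number of elements of P below x.  Columns are handled as predicates on
    entries, since an entry of a column is determined by its rank. *)
Definition cnt (P : nat -> bool) (x : nat) : nat := count P (iota 0 x).

Lemma cntS P x : cnt P x.+1 = cnt P x + P x.
Proof. by rewrite /cnt -addn1 iotaD count_cat /= add0n addn0. Qed.

Lemma cnt_mono P x y : x <= y -> cnt P x <= cnt P y.
Proof. by move=> /subnKC <-; rewrite /cnt iotaD count_cat leq_addr. Qed.

Lemma cnt_inj (P : nat -> bool) x y : P x -> P y -> cnt P x = cnt P y -> x = y.
Proof.
move=> Px Py E; case: (ltngtP x y) => // lt_xy.
  by have := cnt_mono P lt_xy; rewrite cntS Px E addn1 ltnn.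
by have := cnt_mono P lt_xy; rewrite cntS Py E addn1 ltnn.
Qed.

Lemma eq_cnt P Q x : P =1 Q -> cnt P x = cnt Q x.
Proof. by move=> E; apply: eq_count. Qed.

(** The column c of T consists of the x with [w c x], in increasing order.  The
    second condition makes the number of entries of a column at most k. *)
Definition represents T w : Prop :=
  (forall b, w (bcol b) (T b) /\ cnt (w (bcol b)) (T b) = brow b) /\
  (forall c x, c < 2 -> w c x -> cnt (w c) x < k).

Lemma represents_box T w c x : represents T w -> c < 2 -> w c x ->
  exists b, [/\ brow b = cnt (w c) x, bcol b = c & T b = x].
Proof.
move=> [R1 R2] lt_c wx; have [b [Er Ec]] := box_exists (R2 _ _ lt_c wx) lt_c.
exists b; split=> //; have [wb cb] := R1 b; rewrite Ec in wb cb.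
by apply: (cnt_inj wb wx); rewrite cb.
Qed.

Lemma represents_inj T T' w : represents T w -> represents T' w -> T =1 T'.
Proof.
by move=> [R _] [R' _] b; have [w1 c1] := R b; have [w2 c2] := R' b; apply: cnt_inj w1 w2 _; rewrite c1.
Qed.

Lemma represents_ext T w w' :
  represents T w -> (forall c, c < 2 -> w c =1 w' c) -> represents T w'.
Proof.
move=> [R1 R2] E; split=> [b | c x lt_c].
  by rewrite -E ?bcol_lt // -(eq_cnt _ (E _ (bcol_lt b))).
by rewrite -E // -(eq_cnt _ (E _ lt_c)); apply: R2.
Qed.

(** The letters i and i + 1 are an opener and a closer starting from height 0;
    then i and i + 1 lie in the same row and there is nothing to exchange. *)
Definition bk_fixed i w :=
  [&& w 0 i, ~~ w 0 i.+1, ~~ w 1 i, w 1 i.+1 & cnt (w 0) i == cnt (w 1) i].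

Definition bk_word i w c x :=
  if bk_fixed i w then w c x
  else if x == i then w c i.+1 else if x == i.+1 then w c i else w c x.

Lemma cnt_bk_word i w c x :
  cnt (bk_word i w c) x =
    if x == i.+1 then cnt (w c) i + bk_word i w c i else cnt (w c) x.
Proof.
rewrite /bk_word; case: (bk_fixed i w).
  by case: eqP => // ->; rewrite cntS.
elim: x => [|x IHx] //; rewrite !cntS IHx eqSS; have [->|ne1] := eqVneq x i.+1.
  by rewrite eqxx -[i.+1 == i]/(i.+1 == i) gtn_eqF // !cntS; lia.
by have [->|ne] := eqVneq x i; rewrite ?eqxx.
Qed.

Section Step.
Variables (i : nat) (T : box lam -> nat) (w : nat -> nat -> bool).
Hypothesis R : represents T w.

(** By rank, an entry i + 1 in the column can only stand directly below i. *)
Lemma free_loE b : free_lo i T b = (T b == i) && ~~ w (bcol b) i.+1.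
Proof.
rewrite /free_lo; case: eqP => //= Ti; congr (~~ _).
have [wb cb] := R.1 b; rewrite Ti in wb cb.
apply/existsP/idP => [[c /and3P [/eqP <- _ /eqP <-]] | wi]; first exact: (R.1 c).1.
have [c [Er Ec ET]] := represents_box R (bcol_lt b) wi.
by exists c; rewrite Er Ec ET cntS wb cb addn1 !eqxx.
Qed.

Lemma free_hiE b : free_hi i T b = (T b == i.+1) && ~~ w (bcol b) i.
Proof.
rewrite /free_hi; case: eqP => //= Ti; congr (~~ _).
have [wb cb] := R.1 b; rewrite Ti in wb cb.
apply/existsP/idP => [[c /and3P [/eqP <- _ /eqP <-]] | wi]; first exact: (R.1 c).1.
have [c [Er Ec ET]] := represents_box R (bcol_lt b) wi.
by exists c; rewrite Er Ec ET -cb cntS wi addn1 !eqxx.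
Qed.

Lemma card_row (P : pred (box lam)) b0 b1 r : brow b0 = r -> brow b1 = r ->
  bcol b0 = 0 -> bcol b1 = 1 -> #|[set c | (brow c == r) && P c]| = P b0 + P b1.
Proof.
move=> r0 r1 c0 c1; rewrite (cardsD1 b0) (cardsD1 b1) !inE r0 r1 eqxx /= addnA.
have -> /= : b1 != b0 by apply/eqP => E; rewrite E c0 in c1.
rewrite [X in _ + X](_ : _ = 0) ?addn0 //; apply: eq_card0 => c; rewrite !inE.
have := bcol_lt c; case Ec : (bcol c) => [|[|//]] _.
  have [Er|] := eqVneq (brow c) r; last by rewrite !andbF.
  have -> : c = b0 by apply: box_inj; rewrite ?Er ?r0 ?Ec ?c0.
  by rewrite eqxx !andbF.
have [Er|] := eqVneq (brow c) r; last by rewrite !andbF.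
have -> : c = b1 by apply: box_inj; rewrite ?Er ?r1 ?Ec ?c1.
by rewrite eqxx.
Qed.

(** A free cell whose row contains no other free cell changes its entry, which
    exchanges the letters i and i + 1 in its column.  With two free cells in the
    row, i, i turns into i + 1, i + 1 and conversely, which exchanges the letters
    in both columns, whereas i, i + 1 stays as it is. *)
Lemma bender_knuth_represents : represents (bender_knuth i T) (bk_word i w).
Proof.
split=> [b | c x lt_c]; last first.
  have R2 := R.2 c; rewrite cnt_bk_word /bk_word; case: (bk_fixed i w).
    by case: eqP => [->|_] wx; have := R2 _ lt_c wx; rewrite ?cntS.
  have [->|ne] := eqVneq x i => wx.
    by rewrite ltn_eqF //; have := R2 _ lt_c wx; rewrite cntS; lia.
  move: wx; have [_|ne1] := eqVneq x i.+1 => wx; last exact: R2.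
  have := R2 _ lt_c wx; rewrite eqxx; case E : (w c i.+1); last by rewrite addn0.
  by have := R2 _ lt_c E; rewrite cntS wx.
have [b0 [r0 c0]] := box_exists (brow_lt b) (isT : 0 < 2).
have [b1 [r1 c1]] := box_exists (brow_lt b) (isT : 1 < 2).
have [w0 n0] := R.1 b0; have [w1 n1] := R.1 b1.
rewrite c0 r0 in w0 n0; rewrite c1 r1 in w1 n1.
(* an entry is determined by its column and its rank *)
have at0 x : w 0 x -> cnt (w 0) x = brow b -> T b0 = x.
  by move=> wx cx; apply: (cnt_inj w0 wx); rewrite n0.
have at1 x : w 1 x -> cnt (w 1) x = brow b -> T b1 = x.
  by move=> wx cx; apply: (cnt_inj w1 wx); rewrite n1.
have e0 : (T b0 == i) = w 0 i && (cnt (w 0) i == brow b).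
  by apply/eqP/andP => [E | [wi /eqP ci]]; [rewrite -E w0 n0 | apply: at0].
have f0 : (T b0 == i.+1) = w 0 i.+1 && (cnt (w 0) i + w 0 i == brow b).
  by rewrite -cntS; apply/eqP/andP => [E | [wi /eqP ci]]; [rewrite -E w0 n0 | apply: at0].
have e1 : (T b1 == i) = w 1 i && (cnt (w 1) i == brow b).
  by apply/eqP/andP => [E | [wi /eqP ci]]; [rewrite -E w1 n1 | apply: at1].
have f1 : (T b1 == i.+1) = w 1 i.+1 && (cnt (w 1) i + w 1 i == brow b).
  by rewrite -cntS; apply/eqP/andP => [E | [wi /eqP ci]]; [rewrite -E w1 n1 | apply: at1].
have hiE := card_row (free_hi i T) r0 r1 c0 c1.
have leftE : #|[set c | [&& brow c == brow b, bcol c < bcol b & Defs.free i T c]]|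
    = (0 < bcol b) && Defs.free i T b0 :> nat.
  rewrite (card_row (fun c => (bcol c < bcol b) && Defs.free i T c) r0 r1 c0 c1) c0 c1.
  by have := bcol_lt b; case: (bcol b) => [|[|//]] _; rewrite ?addn0.
rewrite /bender_knuth hiE leftE.
have [fb | nfb] := boolP (Defs.free i T b); last first.
  have [wb nb] := R.1 b; move: nfb; rewrite /Defs.free free_loE free_hiE.
  rewrite cnt_bk_word /bk_word.
  move: wb nb; have [-> | ni] := eqVneq (T b) i => wb nb.
    by rewrite /= negb_or negbK => /andP [-> _]; rewrite wb ltn_eqF // nb; case: ifP.
  move: wb nb; have [-> | ni1] := eqVneq (T b) i.+1 => wb nb; last by rewrite wb if_same.
  by rewrite /= negbK => wi; rewrite wi wb !if_same -nb cntS wi.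
have GE y : y = i \/ y = i.+1 ->
    bk_word i w (bcol b) y && (cnt (bk_word i w (bcol b)) y == brow b) ->
    bk_word i w (bcol b) y /\ cnt (bk_word i w (bcol b)) y = brow b.
  by move=> _ /andP [-> /eqP].
set y := if _ < _ then _ else _; apply: (GE y); first by rewrite /y; case: ifP; [left | right].
have Gi c : bk_word i w c i && (cnt (bk_word i w c) i == brow b)
    = (if bk_fixed i w then w c i else w c i.+1) && (cnt (w c) i == brow b).
  by rewrite cnt_bk_word (ltn_eqF (ltnSn i)) /bk_word eqxx.
have Gi1 c : bk_word i w c i.+1 && (cnt (bk_word i w c) i.+1 == brow b)
    = (if bk_fixed i w then w c i.+1 else w c i)
      && (cnt (w c) i + (if bk_fixed i w then w c i else w c i.+1) == brow b).
  by rewrite cnt_bk_word eqxx /bk_word (gtn_eqF (ltnSn i)) !eqxx.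
suff : if (0 < bcol b) && Defs.free i T b0 < free_hi i T b0 + free_hi i T b1
       then bk_word i w (bcol b) i && (cnt (bk_word i w (bcol b)) i == brow b)
       else bk_word i w (bcol b) i.+1 && (cnt (bk_word i w (bcol b)) i.+1 == brow b).
  by rewrite /y; case: ifP.
rewrite Gi Gi1; move: fb; rewrite /Defs.free /bk_fixed.
have := bcol_lt b; case Ec : (bcol b) => [|[|//]] _.
  have Eb : b = b0 by apply: box_inj; rewrite ?r0 ?c0.
  rewrite [free_lo i T b]free_loE [free_hi i T b]free_hiE [T b](congr1 T Eb) Ec.
  rewrite !free_hiE ?free_loE c0 c1 ?e0 f0 ?e1 f1.
  exact: bk_left_column.
have Eb : b = b1 by apply: box_inj; rewrite ?r1 ?c1.
rewrite [free_lo i T b]free_loE [free_hi i T b]free_hiE [T b](congr1 T Eb) Ec.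
rewrite !free_hiE ?free_loE c0 c1 ?e0 f0 ?e1 f1.
exact: bk_right_column.
Qed.

End Step.
End TwoColumns.

(** * Two-column tableaux and ballot pairs *)

Lemma cnt_const P x y : x <= y -> (forall z, x <= z < y -> ~~ P z) -> cnt P y = cnt P x.
Proof.
elim: y => [|y IHy]; first by case: x.
rewrite leq_eqVlt => /predU1P [-> // | ]; rewrite ltnS => le_xy nP.
rewrite cntS; have /negbTE -> : ~~ P y by rewrite nP // le_xy /=.
rewrite addn0 IHy // => z /andP [le_xz lt_zy].
by rewrite nP // le_xz ltnW.
Qed.

(** The rank grows by steps of at most one, so it takes every intermediate value. *)
Lemma cnt_attained (P : nat -> bool) r N : r < cnt P N -> exists x, [/\ x < N, P x & cnt P x = r].
Proof.
elim: N => // N IHN; rewrite cntS; have [/IHN [x [lt_x Px cx]] _ | le_r lt_r] := ltnP r (cnt P N).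
  by exists x; split=> //; apply: ltnW.
exists N; move: lt_r; case: (P N); rewrite ?addn0 ?addn1 => lt_r; split=> //; lia.
Qed.

Section Entries.
Variable n : nat.
Implicit Types (A B : {set 'I_n}).

Definition has_entry A (e : nat) : bool := [exists p : 'I_n, (p \in A) && (p.+1 == e)].

Definition word_fun (w : {set 'I_n} * {set 'I_n}) (c : nat) : nat -> bool :=
  has_entry (if c == 0 then w.1 else w.2).

Lemma has_entryS A (p : 'I_n) : has_entry A p.+1 = (p \in A).
Proof.
apply/existsP/idP => [[q /andP [qA]] | pA]; last by exists p; rewrite pA eqxx.
by rewrite eqSS => /eqP/ord_inj <-.
Qed.

Lemma has_entry0 A : has_entry A 0 = false.
Proof. by apply/existsP => -[p]; rewrite andbF. Qed.

Lemma has_entry_gt A e : n < e -> has_entry A e = false.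
Proof. by move=> lt_e; apply/existsP => -[p]; have := ltn_ord p; lia. Qed.

Lemma cnt_has_entry A t : cnt (has_entry A) t.+1 = prefix_card A t.
Proof.
elim: t => [|t IHt].
  by rewrite cntS has_entry0; apply/esym/eq_card0 => i; rewrite !inE ltn0 andbF.
rewrite cntS IHt; case: (ltnP t n) => [lt_tn | le_nt].
  by have := prefix_cardS A (Ordinal lt_tn); rewrite -has_entryS /= => ->.
rewrite has_entry_gt // addn0; apply: eq_card => i; rewrite !inE.
by have := ltn_ord i => lt_i; rewrite !(leq_trans lt_i) // ltnW.
Qed.

Lemma ballot_cnt (w : {set 'I_n} * {set 'I_n}) :
  reflect (forall x, cnt (word_fun w 1) x <= cnt (word_fun w 0) x) (ballot w).
Proof.
apply: (iffP forallP) => [H [|t] // | H t]; last by rewrite -!cnt_has_entry; apply: H.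
rewrite !cnt_has_entry; case: (leqP t n) => [le_tn | lt_nt].
  exact: (H (Ordinal (le_tn : t < n.+1))).
have E A : prefix_card A t = prefix_card A n.
  apply: eq_card => i; rewrite !inE (ltn_ord i).
  by rewrite (leq_trans (ltn_ord i)) // ltnW.
by rewrite !E; apply: (H ord_max).
Qed.

End Entries.

Section TableauWord.
Variables (k n : nat).
Local Notation lam := (nseq k 2).
Implicit Types (T : SSYT lam n) (b : box lam).

Definition column_set T (c : nat) : {set 'I_n} :=
  [set p : 'I_n | [exists b, (bcol b == c) && (entry T b == p.+1)]].

Definition tableau_word T := (column_set T 0, column_set T 1).

Lemma entry_gt0 T b : 0 < entry T b.
Proof. by case/and3P: (valP T) => /forallP H _ _; apply: H. Qed.

Lemma entry_le T b : entry T b <= n.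
Proof. by rewrite -ltnS; apply: ltn_ord. Qed.

Lemma entry_row T b b' : brow b = brow b' -> bcol b < bcol b' -> entry T b <= entry T b'.
Proof.
case/and3P: (valP T) => _ /forallP /(_ b) /forallP /(_ b') /implyP H _ Er lt_c.
by apply: H; rewrite Er eqxx.
Qed.

Lemma entry_col T b b' : bcol b = bcol b' -> brow b < brow b' -> entry T b < entry T b'.
Proof.
case/and3P: (valP T) => _ _ /forallP /(_ b) /forallP /(_ b') /implyP H Ec lt_r.
by apply: H; rewrite Ec eqxx.
Qed.

Lemma tableau_wordE T c e : c < 2 ->
  word_fun (tableau_word T) c e = [exists b, (bcol b == c) && (entry T b == e)].
Proof.
move=> lt_c; have -> : word_fun (tableau_word T) c = has_entry (column_set T c).
  by case: c lt_c => [|[|//]].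
case: e => [|e].
  rewrite has_entry0; apply/esym/existsP => -[b /andP [_ /eqP E]].
  by have := entry_gt0 T b; rewrite E.
case: (ltnP e n) => [lt_en | le_ne].
  by have := has_entryS (column_set T c) (Ordinal lt_en); rewrite inE /= => ->.
rewrite has_entry_gt //; apply/esym/existsP => -[b /andP [_ /eqP E]].
by have := entry_le T b; rewrite E ltnNge le_ne.
Qed.

(** In a strictly increasing column the rank of an entry is its row. *)
Lemma tableau_cnt T b : cnt (word_fun (tableau_word T) (bcol b)) (entry T b) = brow b.
Proof.
set P := word_fun _ _; have [r Er] : {r | brow b = r} by exists (brow b).
have PE e : P e = [exists b', (bcol b' == bcol b) && (entry T b' == e)].
  exact: tableau_wordE (bcol_lt b).
rewrite Er; have [c Ec] : {c | bcol b = c} by exists (bcol b).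
rewrite Ec in PE; clearbody P; elim: r b Er Ec => [|r IHr] b Er Ec.
  apply: (@cnt_const P 0) => // e lt_e; rewrite PE; apply/existsP => -[b' /andP [/eqP Ec' /eqP E]].
  have [Eb | ne] := eqVneq (brow b') 0.
    by move: lt_e; rewrite -E (@box_inj _ b' b) ?ltnn ?Ec ?Eb.
  by have := @entry_col T b b'; rewrite Ec Ec' Er lt0n ne E => /(_ erefl isT); lia.
have lt_rk : r < k by have := brow_lt b; lia.
have [b' [Er' Ec']] := box_exists lt_rk (bcol_lt b).
have lt_b : entry T b' < entry T b by apply: entry_col; rewrite ?Ec' // Er Er'.
have Pb' : P (entry T b') by rewrite PE; apply/existsP; exists b'; rewrite Ec' Ec !eqxx.
have cb' : cnt P (entry T b') = r by apply: IHr => //; rewrite Ec' Ec.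
rewrite (@cnt_const P (entry T b').+1) //; first by rewrite cntS Pb' cb' addn1.
move=> e /andP [gt_e lt_e]; rewrite PE; apply/existsP => -[b2 /andP [/eqP Ec2 /eqP E]].
have [lt2 | lt2 | E2] := ltngtP (brow b2) r.
- by have := @entry_col T b2 b'; rewrite Ec2 Ec' Ec Er' E => /(_ erefl lt2); lia.
- have [E3 | n3] := eqVneq (brow b2) r.+1.
    by move: lt_e; rewrite -E (@box_inj _ b2 b) ?ltnn ?Ec2 ?E3.
  have := @entry_col T b b2; rewrite Ec2 Ec Er E => /(_ erefl).
  by rewrite ltn_neqAle eq_sym n3 => /(_ lt2); lia.
by move: gt_e; rewrite -E (@box_inj _ b2 b') ?ltnn ?Er' ?Ec2 ?Ec'.
Qed.

Lemma tableau_represents T : represents (entry T) (word_fun (tableau_word T)).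
Proof.
split=> [b | c x lt_c].
  split; last exact: tableau_cnt.
  by rewrite tableau_wordE ?bcol_lt //; apply/existsP; exists b; rewrite !eqxx.
rewrite tableau_wordE // => /existsP [b /andP [/eqP <- /eqP <-]].
by rewrite tableau_cnt brow_lt.
Qed.

Lemma represents_total (T : box lam -> nat) w c N : 0 < k -> represents T w -> c < 2 ->
  (forall x, w c x -> x < N) -> cnt (w c) N = k.
Proof.
move=> k_gt0 [R1 R2] lt_c bnd; have lt_k : k.-1 < k by rewrite prednK.
have [b [Er Ec]] := box_exists lt_k lt_c; have [wb cb] := R1 b; rewrite Ec in wb cb.
rewrite (@cnt_const _ (T b).+1) ?bnd //; first by rewrite cntS wb cb Er addn1 prednK.
move=> x /andP [lt_x _]; apply/negP => wx.
have := R2 _ _ lt_c wx; have := cnt_mono (w c) lt_x; rewrite cntS wb cb Er; lia.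
Qed.

(** If the left column had r entries below x and the right one more than r, the
    right entry in row r would be below x but the left one would not, contrary to
    the weak increase of rows. *)
Lemma tableau_word_ballot T : 0 < k -> tableau_word T \in ballot_set n k.
Proof.
move=> k_gt0; have R := tableau_represents T.
have tot c : c < 2 -> cnt (word_fun (tableau_word T) c) n.+1 = k.
  move=> lt_c; apply: (represents_total k_gt0 R) => // x wx; rewrite ltnNge; apply/negP => lt_nx.
  by move: wx; rewrite /word_fun has_entry_gt.
rewrite inE; apply/and3P; split.
- by have := tot 0 isT; rewrite cnt_has_entry prefix_full => ->.
- by have := tot 1 isT; rewrite cnt_has_entry prefix_full => ->.
apply/ballot_cnt => x; rewrite leqNgt; apply/negP => lt_x.
have lt_k : cnt (word_fun (tableau_word T) 0) x < k.
  apply: leq_trans lt_x _; case: (leqP x n.+1) => [le_x | lt_nx].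
    by rewrite -(tot 1 isT) cnt_mono.
  rewrite (cnt_const (ltnW lt_nx)) ?tot // => y /andP [lt_y _].
  by rewrite /word_fun has_entry_gt.
have [b0 [r0 c0]] := box_exists lt_k (isT : 0 < 2).
have [b1 [r1 c1]] := box_exists lt_k (isT : 1 < 2).
have [w0 n0] := R.1 b0; have [w1 n1] := R.1 b1; rewrite c0 r0 in w0 n0; rewrite c1 r1 in w1 n1.
have lt_1x : entry T b1 < x.
  by rewrite ltnNge; apply/negP => /(cnt_mono (word_fun (tableau_word T) 1)); rewrite n1; lia.
have le01 : entry T b0 <= entry T b1 by apply: entry_row; rewrite ?r0 ?c0 ?c1.
have := cnt_mono (word_fun (tableau_word T) 0) (leq_ltn_trans le01 lt_1x).
by rewrite cntS w0 n0 addn1 ltnn.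
Qed.

Lemma tableau_word_inj : injective tableau_word.
Proof.
move=> T T' E; have R := tableau_represents T; rewrite E in R.
have H := represents_inj R (tableau_represents T').
by apply: val_inj; apply/ffunP => b; apply: val_inj; apply: H.
Qed.

(** The cell in row r receives the element of rank r of its column. *)
Lemma tableau_word_surj w : w \in ballot_set n k -> exists T, tableau_word T = w.
Proof.
rewrite inE => /and3P [/eqP cA /eqP cB /ballot_cnt bal].
have tot c : cnt (word_fun w c) n.+1 = k.
  by rewrite /word_fun; case: (c == 0); rewrite cnt_has_entry prefix_full.
have ex b : exists x : 'I_n.+1, word_fun w (bcol b) x && (cnt (word_fun w (bcol b)) x == brow b).
  have lt_r : brow b < cnt (word_fun w (bcol b)) n.+1 by rewrite tot brow_lt.
  by have [x [lt_x wx cx]] := cnt_attained lt_r; exists (Ordinal lt_x); rewrite /= wx cx eqxx.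
pose F := [ffun b => xchoose (ex b)].
have FP b : word_fun w (bcol b) (F b) /\ cnt (word_fun w (bcol b)) (F b) = brow b.
  by rewrite ffunE; have /andP [? /eqP ?] := xchooseP (ex b).
have ssF : is_ssyt F.
  apply/and3P; split; apply/forallP => b.
  - have [wb _] := FP b; rewrite lt0n; apply: contraL wb => /eqP ->.
    by rewrite /word_fun has_entry0.
  - apply/forallP => b'; apply/implyP => /andP [/eqP Er lt_c].
    have [wb nb] := FP b; have [wb' nb'] := FP b'.
    have := bcol_lt b'; have := bcol_lt b.
    case Ec : (bcol b) lt_c wb nb => [|[|//]]; case Ec' : (bcol b') wb' nb' => [|[|//]] //.
    move=> w1 n1 _ w0 n0 _ _; rewrite leqNgt; apply/negP => lt_10.
    have e1 : cnt (word_fun w 1) (F b').+1 = (brow b').+1 by rewrite cntS w1 n1 addn1.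
    have := cnt_mono (word_fun w 0) lt_10; have := bal (F b').+1.
    by rewrite e1 n0 Er => lt_b' le_b'; have := leq_trans lt_b' le_b'; rewrite ltnn.
  apply/forallP => b'; apply/implyP => /andP [/eqP Ec lt_r].
  have [_ nb] := FP b; have [_ nb'] := FP b'; rewrite ltnNge; apply/negP.
  by move=> /(cnt_mono (word_fun w (bcol b))); rewrite nb Ec nb'; lia.
pose T : SSYT lam n := exist _ F ssF.
have R : represents (entry T) (word_fun w).
  split=> [b | c x lt_c wx]; first exact: FP.
  rewrite -(tot c); have lt_xn : x < n.+1.
    by rewrite ltnNge; apply/negP => lt_nx; move: wx; rewrite /word_fun has_entry_gt.
  by have := cnt_mono (word_fun w c) lt_xn; rewrite cntS wx addn1.
have colE c (p : 'I_n) : c < 2 -> (p \in column_set T c) = word_fun w c p.+1.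
  move=> lt_c; rewrite inE; apply/existsP/idP => [[b /andP [/eqP <- /eqP <-]] | wp].
    exact: (R.1 b).1.
  by have [b [_ Ec ET]] := represents_box R lt_c wp; exists b; rewrite Ec ET !eqxx.
exists T; rewrite [w]surjective_pairing; congr (_, _); apply/setP=> p.
  by rewrite colE // /word_fun has_entryS.
by rewrite colE // /word_fun has_entryS.
Qed.

End TableauWord.

(** * Promotion rotates matchings *)

Lemma promotion_represents k n (T : box (nseq k 2) -> nat) w :
  represents T w -> represents (promotion n T) (foldr bk_word w (iota 1 n.-1)).
Proof.
rewrite /promotion; elim: (iota _ _) => //= i s IHs R.
exact/bender_knuth_represents/IHs.
Qed.

Lemma eq_bk_word i w w' : (forall c, c < 2 -> w c =1 w' c) ->
  forall c, c < 2 -> bk_word i w c =1 bk_word i w' c.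
Proof.
move=> E c lt_c x; have -> : bk_word i w c x = if bk_fixed i w' then w c x
  else if x == i then w c i.+1 else if x == i.+1 then w c i else w c x.
  by rewrite /bk_word /bk_fixed !E // !(eq_cnt _ (E _ _)).
by rewrite !E.
Qed.

Section Slide.
Variables (n : nat) (w : nat -> nat -> bool).

(** The word w after its last letter has been moved to position j. *)
Definition slide_front j c e :=
  if e < j then w c e else if e == j then w c n
  else if e <= n then w c e.-1 else w c e.

(** The word w when its last letter, a closer, has stopped right behind its
    opener at position a, and the opener has been moved to position j. *)
Definition slide_past a j c e :=
  if e < j then w c e else if e == j then c == 0
  else if e <= a then w c e.-1 else if e == a.+1 then c != 0
  else if e <= n then w c e.-1 else w c e.

Lemma iota_down d : d < n -> iota (n - d.+1) d.+1 = (n - d.+1) :: iota (n - d) d.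
Proof. by move=> lt_dn /=; congr (_ :: iota _ _); lia. Qed.

Lemma cnt_prefix P Q x : (forall e, e < x -> P e = Q e) -> cnt P x = cnt Q x.
Proof. by move=> E; apply: eq_in_count => e; rewrite mem_iota => /andP [_ /E]. Qed.

Lemma bk_word_moved i u c e : ~~ bk_fixed i u ->
  bk_word i u c e = if e == i then u c i.+1 else if e == i.+1 then u c i else u c e.
Proof. by rewrite /bk_word => /negbTE ->. Qed.

Lemma slide_front_step j c e : 0 < j < n ->
  (if e == j then slide_front j.+1 c j.+1
   else if e == j.+1 then slide_front j.+1 c j else slide_front j.+1 c e)
  = slide_front j c e.
Proof.
move=> /andP [j_gt0 lt_jn]; rewrite /slide_front !ltnn eqxx ltnSn.
have [->|nj] := eqVneq e j; first by rewrite ltnn.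
have [->|nj1] := eqVneq e j.+1.
  by rewrite ltnNge leqnSn /= lt_jn.
by rewrite ltnS leq_eqVlt (negbTE nj).
Qed.

Lemma slide_front_prefix j c : cnt (slide_front j.+1 c) j = cnt (w c) j.
Proof. by apply: cnt_prefix => e lt_ej; rewrite /slide_front ltnS ltnW. Qed.

(** A neutral letter is never blocked, since a blocked pair ends with a closer. *)
Lemma slide_neutral d : 0 < n -> w 0 n = w 1 n -> d < n ->
  forall c, c < 2 -> foldr bk_word w (iota (n - d) d) c =1 slide_front (n - d) c.
Proof.
move=> n_gt0 Ew; elim: d => [|d IHd] lt_dn c lt_c e.
  rewrite subn0 /= /slide_front; by case: ltngtP => // ->.
rewrite (iota_down (ltnW lt_dn)) /= (@eq_bk_word _ _ (slide_front (n - d))) //; last exact/IHd/ltnW.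
have -> : n - d = (n - d.+1).+1 by lia.
rewrite bk_word_moved; first by apply: slide_front_step; lia.
by rewrite /bk_fixed /slide_front !ltnn eqxx Ew; case: (w 1 n); rewrite ?andbF.
Qed.

(** Behind a the height is positive, so nothing blocks the closer; at a it is
    blocked by its opener, which takes over and is never blocked itself. *)
Lemma slide_closer a d : 0 < a < n -> w 0 n = false -> w 1 n -> w 0 a -> w 1 a = false ->
    cnt (w 0) a = cnt (w 1) a -> (forall e, a < e < n -> cnt (w 1) e < cnt (w 0) e) ->
    d < n -> forall c, c < 2 ->
  foldr bk_word w (iota (n - d) d) c =1
    (if a < n - d then slide_front (n - d) c else slide_past a (n - d) c).
Proof.
move=> /andP [a_gt0 lt_an] w0n w1n w0a w1a eq_a gt_a.
elim: d => [|d IHd] lt_dn c lt_c e.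
  rewrite subn0 /= lt_an /slide_front; by case: ltngtP => // ->.
have cE c' : c' < 2 -> w c' a = (c' == 0) /\ w c' n = (c' != 0).
  by case: c' => [|[|//]]; rewrite ?w0n ?w1n ?w0a ?w1a.
pose S := if a < n - d then slide_front (n - d) else slide_past a (n - d).
rewrite (iota_down (ltnW lt_dn)) /= (@eq_bk_word _ _ S) //; last first.
  by move=> c' lt_c' e'; rewrite (IHd (ltnW lt_dn) _ lt_c') /S; case: ifP.
rewrite {}/S; set j := n - d.+1; have -> : n - d = j.+1 by lia.
have j_gt0 : 0 < j < n by lia.
rewrite ltnS; case: (ltngtP a j) => [lt_aj | lt_ja | Ea].
- rewrite bk_word_moved; first exact: slide_front_step.
  rewrite /bk_fixed !slide_front_prefix.
  by apply/negP => /and5P [_ _ _ _ /eqP E]; have := gt_a j; rewrite E ltnn; lia.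
- rewrite bk_word_moved; last by rewrite /bk_fixed /slide_past !ltnn !eqxx /= andbF.
  rewrite /slide_past !ltnn eqxx ltnSn.
  have [->|nj] := eqVneq e j; first by rewrite ltnn.
  have [->|nj1] := eqVneq e j.+1; first by rewrite ltnNge leqnSn /= lt_ja.
  by rewrite ltnS leq_eqVlt (negbTE nj).
rewrite -{}Ea; have fx : bk_fixed a (slide_front a.+1).
  rewrite /bk_fixed !slide_front_prefix eq_a eqxx.
  by rewrite /slide_front !ltnn eqxx ltnSn w0a w1a w0n w1n.
rewrite /bk_word fx /slide_front /slide_past ltnS.
have [wa wn] := cE c lt_c; rewrite wn.
by case: (ltngtP e a) => // ->.
Qed.

End Slide.

Section Promotion.
Variables (n' k : nat).
Local Notation n := n'.+1.
Implicit Types (pi : {perm 'I_n}) (C : {set 'I_n}).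
Local Notation last := (@ord_max n').

Lemma cdist_last (p : 'I_n) : p <> last -> cdist n last p = p.+1.
Proof.
move=> np; have : nat_of_ord p <> n' by move=> E; apply: np; apply: ord_inj.
by rewrite /cdist /=; have := ltn_ord p; case: (leqP n' p); lia.
Qed.

Section Heights.
Variable pi : {perm 'I_n}.
Hypotheses (mpi : nc_matching pi) (a_lt : pi last < last).
Let inv := (elimT (nc_matchingP pi) mpi).1.

(** The points before the partner of the last point are matched among themselves. *)
Lemma below_last (p : 'I_n) : p < pi last -> pi p < pi last.
Proof.
move=> lt_p; have np : p <> last by move=> E; move: lt_p; rewrite E; lia.
have na : pi last <> last by move/(congr1 val) => E; move: a_lt; rewrite /= E ltnn.
have npp : pi p <> last by move=> E; move: lt_p; rewrite -E inv ltnn.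
have := (elimT (nc_matchingP pi) mpi).2 last p np.
by rewrite !cdist_last // !ltnS; apply.
Qed.

Lemma height_at_opener : prefix_card (linU pi) (pi last) = prefix_card (linD pi) (pi last).
Proof.
apply/eqP; rewrite eqn_leq (lin_prefix _ inv) andbT.
rewrite /prefix_card -(card_imset (mem [set _ in linU pi | _]) (@perm_inj _ pi)).
apply/subset_leq_card/subsetP => i /imsetP [j + ->]; rewrite !inE inv => /andP [-> lt_j].
exact: below_last.
Qed.

(** The opener of the last point is not closed before the last point. *)
Lemma height_past_opener (t : nat) : pi last < t <= last ->
  prefix_card (linD pi) t < prefix_card (linU pi) t.
Proof.
move=> /andP [gt_t le_t].
rewrite /prefix_card -(card_imset (mem [set _ in linD pi | _]) (@perm_inj _ pi)).
apply/proper_card/properP; split.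
  by apply/subsetP => i /imsetP [j + ->]; rewrite !inE inv; lia.
exists (pi last); first by rewrite !inE inv a_lt gt_t.
apply/imsetP => -[j jD /perm_inj Ej]; move: jD; rewrite -Ej !inE => /andP [_ lt_t].
by have := leq_trans lt_t le_t; rewrite ltnn.
Qed.

End Heights.

(** If the last point is unmatched, its letter moves to the front.  Otherwise it
    is a closer; after the rotation the new first point is the opener of the
    arc, and its other end has turned into a closer. *)
Lemma promotion_word pi C : (pi, C) \in match_set n k ->
  forall c, c < 2 ->
    foldr bk_word (word_fun (lin_word (pi, C))) (iota 1 n.-1) c
      =1 word_fun (lin_word (rotmatch (pi, C))) c.
Proof.
rewrite inE /= => /and3P [mpi /forall_inP fC _].
have [inv nc] := elimT (nc_matchingP pi) mpi.
set w := word_fun _; set w' := word_fun _.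
have wE c (p : 'I_n) : c < 2 ->
    w c p.+1 = (if c == 0 then p < pi p else pi p < p) || (p \in C).
  move=> lt_c.
  have -> : w c = has_entry (if c == 0 then linU pi :|: C else linD pi :|: C).
    by case: c lt_c => [|[|//]].
  by rewrite has_entryS; case: (c == 0); rewrite !inE.
have w'E c (p : 'I_n) : c < 2 -> w' c (ordS p).+1 =
    (if c == 0 then ordS p < ordS (pi p) else ordS (pi p) < ordS p) || (p \in C).
  move=> lt_c; have -> : w' c = has_entry
      (if c == 0 then linU (pi ^ rotperm n)%g :|: rotset C else linD (pi ^ rotperm n)%g :|: rotset C).
    by case: c lt_c => [|[|//]].
  by rewrite has_entryS; case: (c == 0); rewrite !inE conj_rotperm mem_rotset.
have ordSE (p : 'I_n) : p <> last -> ordS p = p.+1 :> nat.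
  move=> np; rewrite /= modn_small //.
  by have := ltn_ord p; rewrite leq_eqVlt => /orP [/eqP [E]|//]; case: np; apply: ord_inj.
have ordSlast : ordS last = 0 :> nat by rewrite /= modnn.
have w0 c : w c 0 = false by rewrite /w /word_fun has_entry0.
have w'0 c : w' c 0 = false by rewrite /w' /word_fun has_entry0.
have wn c e : n < e -> w c e = false by move=> ?; rewrite /w /word_fun has_entry_gt.
have w'n c e : n < e -> w' c e = false by move=> ?; rewrite /w' /word_fun has_entry_gt.
(* away from the arc of the last point, letters move one step to the right *)
have keep c (p : 'I_n) : c < 2 -> p <> last -> pi p <> last -> w' c p.+2 = w c p.+1.
  by move=> lt_c np npp; rewrite wE // -(ordSE p np) w'E // !ordSE.
have en e : 1 < e <= n -> exists2 p : 'I_n, e = p.+2 & p <> last.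
  case/andP; case: e => [|[|e]] // _ le_e; exists (Ordinal (ltnW le_e : e < n)) => //.
  by move/(congr1 val) => /= E; rewrite E ltnn in le_e.
have w'1 c : c < 2 -> w' c 1 = (if c == 0 then 0 < ordS (pi last) else false) || (last \in C).
  by move=> lt_c; rewrite -[1]/(0.+1) -ordSlast w'E // ordSlast.
have wlast c : c < 2 -> w c n = (if c == 0 then false else pi last < last) || (last \in C).
  move=> lt_c; rewrite -[n]/(nat_of_ord last).+1 wE //; case: (c == 0) => //.
  by rewrite ltnNge -ltnS ltn_ord.
have Dn : n - n.-1 = 1 by rewrite subSnn.
have [E | ne] := eqVneq (pi last) last.
  have Ew : w 0 n = w 1 n by rewrite !wlast // E ltnn.
  move=> c lt_c e; have := @slide_neutral n w n.-1 isT Ew (leqnn _) c lt_c e.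
  rewrite Dn => ->; rewrite /slide_front.
  case: e => [|[|e]] /=; first by rewrite w0 w'0.
    by rewrite wlast // w'1 // E ordSlast ltnn; case: (c == 0).
  case: ifP => [le_e | /negbT]; last by rewrite -ltnNge => lt_e; rewrite wn // w'n.
  have [p [->] np] := en e.+2 le_e.
  by rewrite keep // => Ep; apply: np; rewrite -(inv p) Ep.
have a_lt : pi last < last.
  by rewrite ltn_neqAle -ltnS ltn_ord andbT; apply: contraNneq ne => /ord_inj ->.
have nC : last \notin C by apply: contraNN ne => /fC.
have naC : pi last \notin C by apply: contraNN ne => /fC; rewrite inv eq_sym.
have hgt (t : nat) c : c < 2 -> cnt (w c) t.+1 =
    prefix_card (if c == 0 then linU pi else linD pi) t + prefix_card C t.
  move=> lt_c; rewrite /w /word_fun cnt_has_entry; case: c lt_c => [|[|//]] _ /=.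
    apply: prefix_cardU; rewrite disjoint_sym disjoint_subset; apply/subsetP => i /fC /eqP E.
    by rewrite !inE E ltnn.
  apply: prefix_cardU; rewrite disjoint_sym disjoint_subset; apply/subsetP => i /fC /eqP E.
  by rewrite !inE E ltnn.
pose a := (pi last).+1.
have a_n : 0 < a < n by [].
have H1 : w 0 n = false by rewrite wlast // (negbTE nC).
have H2 : w 1 n by rewrite wlast // a_lt.
have H3 : w 0 a by rewrite wE // inv a_lt.
have H4 : w 1 a = false by rewrite wE // inv (negbTE naC) orbF /= ltnNge ltnW.
have H5 : cnt (w 0) a = cnt (w 1) a by rewrite !hgt // height_at_opener.
have H6 e : a < e < n -> cnt (w 1) e < cnt (w 0) e.
  case: e => // e /andP [gt_e lt_e]; rewrite !hgt // ltn_add2r.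
  by apply: height_past_opener => //; rewrite (gt_e : pi last < e) (ltnW lt_e : e <= last).
move=> c lt_c e; have := @slide_closer n w a n.-1 a_n H1 H2 H3 H4 H5 H6 (leqnn _) c lt_c e.
rewrite Dn => ->; rewrite ltnS leqn0 /=.
rewrite /slide_past; case: e => [|[|e]] /=; first by rewrite w0 w'0.
  by rewrite w'1 // (negbTE nC) orbF; case: (c == 0) => //; rewrite ordSE //; apply/eqP.
have [E | ne2] := eqVneq e.+2 a.+1.
  have -> : e.+2 <= a = false by rewrite E ltnn.
  case: E => ->; rewrite -(ordSE (pi last)) ?w'E //; last by apply/eqP.
  rewrite inv (negbTE naC) orbF ordSlast ordSE; last by apply/eqP.
  by case: (c == 0).
suff -> : w' c e.+2 = if e.+2 <= n then w c e.+1 else w c e.+2.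
  by case: (ltngtP e.+2 a) => // lt_a; rewrite ifT //; move: a_n lt_a; clear; lia.
case: ifP => [le_e | /negbT]; last by rewrite -ltnNge => lt_e; rewrite wn // w'n.
have [p [Ep] np] := en e.+2 le_e; rewrite Ep keep // => Epp.
by move/eqP: ne2; apply; rewrite Ep /a -Epp inv.
Qed.

End Promotion.

(** * Promotion as a permutation of the tableaux *)

Lemma card_match_set n k : #|match_set n k| = #|ballot_set n k|.
Proof.
rewrite -(card_in_imset (@lin_word_inj n k)); apply: eq_card => w.
apply/imsetP/idP => [[x xM ->] | /lin_word_surj [x xM <-]]; last by exists x.
exact: lin_word_ballot.
Qed.

Lemma card_tableaux n k : 0 < k -> #|SSYT (nseq k 2) n| = #|ballot_set n k|.
Proof.
move=> k_gt0; rewrite -cardsT -(card_imset _ (@tableau_word_inj k n)).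
apply: eq_card => w; apply/imsetP/idP => [[T _ ->] | ]; first exact: tableau_word_ballot.
by case/tableau_word_surj => T <-; exists T; rewrite ?inE.
Qed.

Lemma promotion_perm n k : 0 < k ->
  exists P : {perm SSYT (nseq k 2) n.+1},
    [/\ (P ^+ n.+1 = 1)%g,
        forall T b, entry (P T) b = promotion n.+1 (entry T) b
      & forall s, #|[set T | (P ^+ s)%g T == T]|
          = #|[set x in match_set n.+1 k | iter s (@rotmatch n.+1) x == x]|].
Proof.
move=> k_gt0; pose m := n.+1.
have ex (T : SSYT (nseq k 2) m) :
    exists x, (x \in match_set m k) && (lin_word x == tableau_word T).
  have [x xM xT] := lin_word_surj (tableau_word_ballot T k_gt0).
  by exists x; rewrite xM xT eqxx.
pose beta T := xchoose (ex T).
have betaM T : beta T \in match_set m k by case/andP: (xchooseP (ex T)).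
have betaE T : lin_word (beta T) = tableau_word T by case/andP: (xchooseP (ex T)) => _ /eqP.
have beta_inj : injective beta.
  by move=> T T' E; apply: tableau_word_inj; rewrite -!betaE E.
have codomE x : (x \in codom beta) = (x \in match_set m k).
  apply/codomP/idP => [[T ->] // | xM].
  have [T TE] := tableau_word_surj (lin_word_ballot xM); exists T.
  by apply: (lin_word_inj xM (betaM T)); rewrite betaE TE.
have stable T : rotmatch (beta T) \in codom beta by rewrite codomE rotmatch_stable.
have [P [PE fixE]] := perm_of_stable (@rotmatch_inj m) beta_inj stable.
exists P; split=> [|T b|s].
- by apply/permP => T; apply: beta_inj; rewrite PE iter_rotmatch_full perm1.
- have R := promotion_represents m (tableau_represents T).
  have R' := tableau_represents (P T).
  apply: (represents_inj R'); apply: represents_ext R _ => c lt_c e.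
  rewrite -!betaE -[P]expg1 PE /=.
  by have := betaM T; case: (beta T) => pi C piM; apply: promotion_word piM _ lt_c e.
rewrite fixE; apply: eq_card => x; rewrite !inE -/m codomE.
by rewrite inE.
Qed.

(** * Pairs of subsets with a prescribed difference of sums *)

Lemma sum_shift p (f : nat -> nat) x : (forall y, f (y + p) = f y) ->
  \sum_(u < p) f (x + u) = \sum_(u < p) f u.
Proof.
move=> per; elim: x => [|x IHx]; first by apply: eq_bigr => u _; rewrite add0n.
rewrite -IHx; case: p per {IHx} => [|p] per; first by rewrite !big_ord0.
rewrite big_ord_recr [RHS]big_ord_recl /= addn0 addnC; congr (_ + _).
  by rewrite addSnnS per.
by apply: eq_bigr => u _; rewrite /bump /= addSnnS.
Qed.

(** Double counting of the sum of f over all windows [x, x + p) with x < n: by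
    the period p all windows have the same sum, and by the period n every value
    of f is covered p times. *)
Lemma sum_window n p (f : nat -> nat) :
    (forall y, f (y + n) = f y) -> (forall y, f (y + p) = f y) ->
  n * \sum_(u < p) f u = p * \sum_(x < n) f x.
Proof.
move=> pern perp; transitivity (\sum_(x < n) \sum_(u < p) f (x + u)).
  by under [RHS]eq_bigr => x _ do rewrite sum_shift //; rewrite sum_nat_const card_ord.
rewrite exchange_big /=.
under eq_bigr => u _ do under eq_bigr => x _ do rewrite addnC.
by under eq_bigr => u _ do rewrite sum_shift //; rewrite sum_nat_const card_ord.
Qed.

Section SumStatistic.
Variable n : nat.
Hypothesis n_gt0 : 0 < n.
Implicit Types (A B : {set 'I_n}).

Definition set_sum A := \sum_(i in A) i.

Lemma set_sum_rot A : set_sum (rotset A) = set_sum A + #|A| %[mod n].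
Proof.
rewrite /set_sum big_imset /=; last by move=> i j _ _; apply: ordS_inj.
rewrite -sum1_card -big_split /=.
by elim/big_ind2: _ => // [x y z t Ex Et | i _]; [rewrite -modnDm Ex Et modnDm | rewrite modn_mod addn1].
Qed.

(** The difference of the sums modulo n, with n - 1 in place of - 1. *)
Definition diff_sum (w : {set 'I_n} * {set 'I_n}) := (set_sum w.1 + n.-1 * set_sum w.2) %% n.

Lemma diff_sum_rotl A B : diff_sum (rotset A, B) = (diff_sum (A, B) + #|A|) %% n.
Proof.
by rewrite /diff_sum /= -modnDml set_sum_rot modnDml addnAC modnDml.
Qed.

Lemma diff_sum_rot A B : #|A| = #|B| -> diff_sum (rotset A, rotset B) = diff_sum (A, B).
Proof.
move=> cAB; rewrite /diff_sum /= -modnDm set_sum_rot -modnMmr set_sum_rot modnMmr modnDm.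
rewrite mulnDr addnACA -cAB -mulSn prednK //.
by rewrite addnC mulnC modnMDl.
Qed.

Section Count.
Variables (s j : nat).

Definition periodic_pairs : {set {set 'I_n} * {set 'I_n}} :=
  [set w | [&& iter s (@rotset n) w.1 == w.1, iter s (@rotset n) w.2 == w.2,
               #|w.1| == j & #|w.2| == j]].

Definition diff_count t := #|[set w in periodic_pairs | diff_sum w == t %% n]|.

Lemma card_diff_count p : p <= n ->
  #|[set w in periodic_pairs | diff_sum w < p]| = \sum_(u < p) diff_count u.
Proof.
elim: p => [|p IHp] le_pn.
  by rewrite big_ord0; apply: eq_card0 => w; rewrite !inE andbF.
rewrite big_ord_recr -(IHp (ltnW le_pn)) /= /diff_count modn_small //.
set S := [set w in periodic_pairs | diff_sum w == p].
set S' := [set w in periodic_pairs | diff_sum w < p].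
have /eqP <- : #|S' :|: S| == #|S'| + #|S|.
  rewrite leq_card_setU disjoint_subset; apply/subsetP => w; rewrite !inE.
  by case/andP => _ lt_p; rewrite negb_and (ltn_eqF lt_p) orbT.
by apply: eq_card => w; rewrite !inE -andb_orr ltnS leq_eqVlt orbC.
Qed.

(** Rotate the first set only. *)
Lemma diff_countD t : diff_count (t + j) = diff_count t.
Proof.
pose rotl (w : {set 'I_n} * {set 'I_n}) := (rotset w.1, w.2).
have rotl_inj : injective rotl by case=> A B [A' B'] [/rotset_inj -> ->].
rewrite /diff_count -[RHS](card_imset _ rotl_inj); apply: eq_card => w.
have rot_surj A : exists A', A = rotset A'.
  exists [set i | ordS i \in A]; apply/setP=> i.
  by rewrite -(ord_predK i) mem_rotset inE.
case: w => A B; have [A' ->] := rot_surj A.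
have -> : ((rotset A', B) \in [set rotl x | x in [set w in periodic_pairs | diff_sum w == t %% n]])
    = ((A', B) \in [set w in periodic_pairs | diff_sum w == t %% n]).
  by rewrite -[(rotset A', B)]/(rotl (A', B)) mem_imset.
rewrite !inE /= card_rotset -iterSr iterS (inj_eq (@rotset_inj n)).
case: eqP => //= _; case: eqP => //= _; case: (#|A'| =P j) => //= cA.
case: (#|B| == j) => //=; rewrite diff_sum_rotl cA.
by rewrite eqn_modDr [diff_sum _]/diff_sum modn_mod.
Qed.

Lemma diff_countDn t : diff_count (t + n) = diff_count t.
Proof. by rewrite /diff_count modnDr. Qed.

Lemma card_periodic_pairs : s %| n -> #|periodic_pairs| = sparse_bin (n %/ s) n j ^ 2.
Proof.
move=> sn; rewrite -mulnn -(card_periodic n_gt0 sn j) -cardsX.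
by apply: eq_card => w; rewrite !inE andbACA !andbA.
Qed.

(** The proportion p / n of the periodic pairs, by [sum_window]. *)
Lemma card_window p : s %| n -> p <= n -> (forall t, diff_count (t + p) = diff_count t) ->
  n * #|[set w in periodic_pairs | diff_sum w < p]| = p * sparse_bin (n %/ s) n j ^ 2.
Proof.
move=> sn le_pn perp; rewrite (card_diff_count le_pn) (sum_window diff_countDn perp).
rewrite -(card_diff_count (leqnn n)) -(card_periodic_pairs sn); congr (_ * _).
by apply: eq_card => w; rewrite inE andbC /diff_sum ltn_mod n_gt0.
Qed.

End Count.

End SumStatistic.

(** * An action of order n with the required fixed points *)

Section FreeOrbits.
Variables (Z : finType) (Q : {perm Z}) (n : nat).
Hypotheses (n_gt0 : 0 < n) (Qn : (Q ^+ n = 1)%g).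
Implicit Types (K : {set Z}).

Lemma porbit_dvd z : #|porbit Q z| %| n.
Proof.
by apply: (@dvdn_trans #[Q]%g); [rewrite porbitE dvdn_orbit | rewrite order_dvdn Qn].
Qed.

(** The first n elements of the orbit are distinct. *)
Lemma free_expg_neq s z : #|porbit Q z| = n -> 0 < s < n -> (Q ^+ s)%g z != z.
Proof.
move=> cz /andP [s_gt0 lt_sn]; apply/eqP => Qs.
have := uniq_traject_porbit Q z; rewrite cz => /(uniqP z) /(_ s 0).
rewrite !inE size_traject => /(_ lt_sn n_gt0); rewrite !nth_traject // -permX Qs => /(_ erefl).
by move=> s0; rewrite s0 in s_gt0.
Qed.

Lemma porbit_expg z : (Q ^+ #|porbit Q z|)%g z = z.
Proof. by rewrite permX iter_porbit. Qed.

Lemma porbit_next z : porbit Q (Q z) = porbit Q z.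
Proof. by have := porbit_perm Q 1 z; rewrite expg1. Qed.

(** The complement of an orbit in an invariant set is again invariant. *)
Lemma remove_free_orbits K r :
    (forall z, (Q z \in K) = (z \in K)) ->
    n * r <= #|[set z in K | #|porbit Q z| == n]| ->
  exists K' : {set Z},
    [/\ K' \subset K, forall z, (Q z \in K') = (z \in K'),
        forall z, z \in K -> #|porbit Q z| != n -> z \in K' & #|K'| + n * r = #|K|].
Proof.
move=> stK; elim: r => [|r IHr] leK.
  by exists K; split=> //; rewrite muln0 addn0.
have [K1 [sub st nf cK]] : exists K' : {set Z},
    [/\ K' \subset K, forall z, (Q z \in K') = (z \in K'),
        forall z, z \in K -> #|porbit Q z| != n -> z \in K' & #|K'| + n * r = #|K|].
  by apply: IHr; apply: leq_trans leK; rewrite leq_mul2l leqnSn orbT.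
(* K1 has lost free elements only, and fewer of them than K contains *)
have [z zK1 fz] : exists2 z, z \in K1 & #|porbit Q z| = n.
  have := cardsID [set z | #|porbit Q z| == n] K1.
  have := cardsID [set z | #|porbit Q z| == n] K.
  have [-> | [z]] := set_0Vmem (K1 :&: [set z | #|porbit Q z| == n]); last first.
    by rewrite !inE => /andP [zK /eqP fz]; exists z.
  have : #|K1 :\: [set z | #|porbit Q z| == n]| <= #|K :\: [set z | #|porbit Q z| == n]|.
    exact/subset_leq_card/setSD.
  have <- : [set z in K | #|porbit Q z| == n] = K :&: [set z | #|porbit Q z| == n].
    by apply/setP=> z; rewrite !inE.
  by move: n_gt0 leK cK; rewrite cards0 mulnS => *; exfalso; lia.
exists (K1 :\: porbit Q z); split.
- by apply: subset_trans sub; apply: subsetDl.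
- by move=> y; rewrite !inE st -!eq_porbit_mem porbit_next.
- move=> y yK ny; rewrite inE nf // andbT -eq_porbit_mem; apply: contraNN ny => /eqP ->.
  by rewrite fz.
have subz : porbit Q z \subset K1.
  apply/subsetP => y /porbitP [i ->]; elim: i => [|i IHi]; first by rewrite expg0 perm1.
  by rewrite expgSr permM st.
have := cardsID (porbit Q z) K1; rewrite (setIidPr subz) fz mulnS => cz.
by rewrite -cK -cz; lia.
Qed.

End FreeOrbits.

Section SumModel.
Variables (n k : nat).
Hypotheses (k_gt0 : 0 < k) (lt_kn : k < n).

Let n_gt0 : 0 < n. Proof. exact: leq_ltn_trans lt_kn. Qed.

Definition rotpair (w : {set 'I_n} * {set 'I_n}) := (rotset w.1, rotset w.2).

Lemma rotpair_inj : injective rotpair.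
Proof. by case=> A B [A' B'] [/rotset_inj -> /rotset_inj ->]. Qed.

Definition rotpair_perm := perm rotpair_inj.

Lemma rotpair_expg s w :
  (rotpair_perm ^+ s)%g w = (iter s (@rotset n) w.1, iter s (@rotset n) w.2).
Proof.
elim: s => [|s IHs]; first by rewrite expg0 perm1; case: w.
by rewrite expgSr permM IHs permE.
Qed.

Lemma rotpair_full : (rotpair_perm ^+ n = 1)%g.
Proof. by apply/permP => w; rewrite rotpair_expg !iter_rotset_full perm1; case: w. Qed.

(** The lengths n - k and k + 1 of the windows are the coefficients in
    [evq_qNarayana_full].  The number of pairs with a given difference has the
    size of the sets as a period modulo n, so the length of either window is a
    period as well, as [sum_window] requires. *)
Definition sum_model : {set {set 'I_n} * {set 'I_n}} :=
  [set w : {set 'I_n} * {set 'I_n} | [&& #|w.1| == k, #|w.2| == k & diff_sum w < n - k]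
        || [&& #|w.1| == k.+1, #|w.2| == k.+1 & diff_sum w < k.+1]].

Lemma sum_model_stable w : (rotpair_perm w \in sum_model) = (w \in sum_model).
Proof.
rewrite permE !inE /= !card_rotset; case: (#|w.1| =P #|w.2|) => [E | ne].
  by case: w E => A B E; rewrite diff_sum_rot.
congr orb; apply/and3P/and3P => -[/eqP E1 /eqP E2 _];
  by case: ne; rewrite E1 E2.
Qed.

Lemma card_sum_model_fixed s : s %| n ->
  n * #|[set w in sum_model | (rotpair_perm ^+ s)%g w == w]| =
    (n - k) * sparse_bin (n %/ s) n k ^ 2 + k.+1 * sparse_bin (n %/ s) n k.+1 ^ 2.
Proof.
move=> sn.
rewrite -(@card_window n n_gt0 s k (n - k)) ?leq_subr //; last first.
  by move=> t; rewrite -(diff_countD n s k) -addnA subnK ?diff_countDn // ltnW.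
rewrite -(@card_window n n_gt0 s k.+1 k.+1) //; last exact: diff_countD.
rewrite -mulnDr; congr (_ * _).
set S1 := [set w in periodic_pairs n s k | _]; set S2 := [set w in periodic_pairs n s k.+1 | _].
have /eqP <- : #|S1 :|: S2| == #|S1| + #|S2|.
  rewrite leq_card_setU disjoint_subset; apply/subsetP => w; rewrite !inE.
  case/andP => /and4P [_ _ /eqP -> _] _.
  by rewrite (ltn_eqF (ltnSn k)) /= !andbF.
apply: eq_card => -[A B]; rewrite !inE rotpair_expg xpair_eqE /=.
case: (iter s _ _ == _); case: (iter s _ _ == _); rewrite ?andbF ?andbT //=.
by rewrite !andbA.
Qed.

(** One term of the Vandermonde sum gives C(s, i)^t <= C(t s, t i) by induction on t. *)
Lemma sparse_bin_sqr e j : 1 < e -> e %| n -> sparse_bin e n j ^ 2 <= 'C(n, j).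
Proof.
move=> e1 en; rewrite /sparse_bin; case: ifP => // /dvdnP [i ->].
rewrite -{2}(divnK en) mulnK ?(ltnW e1) // mulnC [i * e]mulnC.
set s := n %/ e; have [lt_si | le_is] := ltnP s i; first by rewrite bin_small // exp0n.
have power_le t : 'C(s, i) ^ t <= 'C(t * s, t * i).
  elim: t => [|t IHt]; first by rewrite !mul0n bin0 expn0.
  rewrite expnS !mulSn -binomial.Vandermonde.
  have lt_i : i < (i + t * i).+1 by rewrite ltnS leq_addr.
  rewrite (bigD1 (Ordinal lt_i)) //= addKn; apply: leq_trans (leq_addr _ _).
  exact: leq_mul.
apply: leq_trans (power_le e); rewrite leq_pexp2l ?bin_gt0 //.
Qed.

(** Since e cannot divide both k and k + 1, only one of the two families
    contributes; (n - k) C(n, k) = (k + 1) C(n, k + 1) = n C(n - 1, k). *)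
Lemma sum_model_fixed_le e : 1 < e -> e %| n ->
  #|[set w in sum_model | (rotpair_perm ^+ (n %/ e))%g w == w]| <= 'C(n.-1, k).
Proof.
move=> e1 en; rewrite -(leq_pmul2l n_gt0) card_sum_model_fixed ?dvdn_div //.
have -> : n %/ (n %/ e) = e by rewrite divnA // mulKn.
have sk := sparse_bin_sqr k e1 en; have sk1 := sparse_bin_sqr k.+1 e1 en.
have Ek : n * 'C(n.-1, k) = (n - k) * 'C(n, k) by rewrite mul_bin_down.
have Ek1 : n * 'C(n.-1, k) = k.+1 * 'C(n, k.+1) by rewrite mul_bin_diag.
have [ek | nek] := boolP (e %| k).
  have -> : sparse_bin e n k.+1 = 0.
    by rewrite /sparse_bin -addn1 dvdn_addr // dvdn1 (gtn_eqF e1).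
  by rewrite exp0n // muln0 addn0 Ek leq_mul2l sk orbT.
have -> : sparse_bin e n k = 0 by rewrite /sparse_bin (negbTE nek).
by rewrite exp0n // muln0 Ek1 leq_mul2l sk1 orbT.
Qed.

Lemma sum_model_fixed_dvd e w : e %| n -> w \in sum_model ->
  (rotpair_perm ^+ (n %/ e))%g w = w -> (e %| k) || (e %| k.+1).
Proof.
move=> en wM fw; apply/negPn/negP; rewrite negb_or => /andP [nk nk1].
have := @card_sum_model_fixed (n %/ e); rewrite dvdn_div // => /(_ isT).
have -> : n %/ (n %/ e) = e by rewrite divnA // mulKn.
rewrite /sparse_bin (negbTE nk) (negbTE nk1) !exp0n // !muln0 => /eqP.
rewrite muln_eq0 (gtn_eqF n_gt0) /= => /eqP /card0_eq /(_ w).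
by rewrite !inE in wM *; rewrite wM fw eqxx.
Qed.

(** Induction on r with Pascal's rule: each step adds at least a. *)
Lemma bin_gt_mul a r : a * r < 'C(a + r, a).
Proof.
case: a => [|a]; first by rewrite mul0n bin0.
elim: r => [|r IHr]; first by rewrite muln0 addn0 binn.
rewrite mulnS addnS binS addnC -addSn; apply: leq_add => //.
rewrite -[X in X <= _](@binSn a); apply: leq_bin2l; exact: leq_addr.
Qed.

Lemma card_bigcup_seq (I : Type) (s : seq I) (T : finType) (F : I -> {set T}) b :
  (forall i, #|F i| <= b) -> #|\bigcup_(i <- s) F i| <= size s * b.
Proof.
move=> le_b; elim: s => [|i s IHs]; first by rewrite big_nil cards0.
rewrite big_cons mulSn; apply: leq_trans (leq_add (le_b i) IHs).
exact: leq_card_setU.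
Qed.

(** An element outside the free orbits is fixed by a rotation of some order
    e > 1 with e | n, and e divides k and n - k or k + 1 and n - k - 1.  So there
    are at most min (k, n - k - 1) such e, each with at most C(n - 1, k) fixed
    points, whereas (k + 1) N = C(n, k) C(n - 1, k) and C(n, k) > k (n - k). *)
Lemma sum_model_nonfree_le N : k.+1 < n -> n * N = 'C(n, k) * 'C(n, k.+1) ->
  #|[set w in sum_model | #|porbit rotpair_perm w| != n]| <= N.
Proof.
move=> lt_k1n EN; pose b := minn k (n - k.+1).
pose F e := if (1 < e) && (e %| n)
            then [set w in sum_model | (rotpair_perm ^+ (n %/ e))%g w == w] else set0.
have F_le e : #|F e| <= 'C(n.-1, k).
  rewrite /F; case: ifP => [/andP [e1 en] | _]; last by rewrite cards0.
  exact: sum_model_fixed_le.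
have sub : [set w in sum_model | #|porbit rotpair_perm w| != n] \subset \bigcup_(e <- iota 2 b) F e.
  apply/subsetP => w; rewrite inE => /andP [wM nw].
  set c := #|porbit _ w| in nw.
  have cn : c %| n by apply: porbit_dvd; exact: rotpair_full.
  have c_gt0 : 0 < c := dvdn_gt0 n_gt0 cn.
  pose e := n %/ c; have Dn : n = e * c by rewrite divnK.
  have ec : n %/ e = c by rewrite {1}Dn mulKn // divn_gt0 // dvdn_leq.
  have e1 : 1 < e.
    rewrite ltn_divRL // mul1n ltn_neqAle nw; exact: dvdn_leq.
  have en : e %| n by rewrite Dn dvdn_mulr.
  have fw : (rotpair_perm ^+ (n %/ e))%g w = w by rewrite ec porbit_expg.
  have eb : e \in iota 2 b.
    rewrite mem_iota e1 /b /=; have := sum_model_fixed_dvd en wM fw.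
    case/orP => ek.
      have := dvdn_leq k_gt0 ek.
      have /dvdn_leq : e %| n - k by rewrite dvdn_sub.
      by move: lt_k1n; clear; lia.
    have := dvdn_leq (ltn0Sn k) ek.
    have /dvdn_leq : e %| n - k.+1 by rewrite dvdn_sub.
    by move: lt_k1n; clear; lia.
  rewrite (big_rem e) //= inE; apply/orP; left.
  by rewrite /F e1 en inE wM fw eqxx.
apply: (leq_trans (subset_leq_card sub)).
apply: (leq_trans (card_bigcup_seq _ F_le)); rewrite size_iota.
have Ek1 : n * 'C(n.-1, k) = k.+1 * 'C(n, k.+1) by rewrite mul_bin_diag.
have EkN : k.+1 * N = 'C(n, k) * 'C(n.-1, k).
  apply/eqP; rewrite -(eqn_pmul2l n_gt0); apply/eqP.
  transitivity (k.+1 * (n * N)); first by ring.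
  by rewrite EN; transitivity ('C(n, k) * (k.+1 * 'C(n, k.+1))); [ring | rewrite -Ek1; ring].
rewrite -(leq_pmul2l (ltn0Sn k)) EkN mulnA leq_mul2r; apply/orP; right.
have := bin_gt_mul k (n - k); rewrite subnKC; last exact: ltnW.
apply: leq_trans; rewrite /b; move: lt_k1n; clear -k.
set r := n - k => lt_k1n; have -> : n - k.+1 = r.-1 by rewrite /r; lia.
have r1 : 1 < r by rewrite /r; lia.
clearbody r; case: (leqP r k) => [le_rk | lt_kr].
  by rewrite (minn_idPr _) ?(leq_trans (leq_pred r)) //; nia.
by rewrite (minn_idPl _) //; nia.
Qed.

(** Removing |X| free orbits from [sum_model] leaves |X| elements.  For k = n - 1
    there may be too few free orbits, but then X is a singleton and the identity
    has the required fixed points. *)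
Lemma order_n_perm (X : finType) : n * #|X| = 'C(n, k) * 'C(n, k.+1) ->
  exists P : {perm X}, (P ^+ n = 1)%g /\ forall s, s %| n -> s < n ->
    n * #|[set x | (P ^+ s)%g x == x]| =
      (n - k) * sparse_bin (n %/ s) n k ^ 2 + k.+1 * sparse_bin (n %/ s) n k.+1 ^ 2.
Proof.
move=> EX; have [lt_k1n | le_nk1] := ltnP k.+1 n; last first.
  have En : n = k.+1 by apply/eqP; rewrite eqn_leq le_nk1.
  have X1 : #|X| = 1.
    apply/eqP; rewrite -(eqn_pmul2l n_gt0) EX muln1 {2}En binn muln1.
    by rewrite {1}En binSn -En.
  exists 1%g; split=> [|s sn lt_sn]; first by rewrite expg1n.
  have s_gt0 : 0 < s := dvdn_gt0 n_gt0 sn.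
  have e1 : 1 < n %/ s by rewrite ltn_divRL // mul1n.
  have en : n %/ s %| n by rewrite dvdn_div.
  rewrite (_ : [set x | _] = setT) ?cardsT ?X1; last first.
    by apply/setP=> x; rewrite !inE expg1n perm1 eqxx.
  rewrite /sparse_bin -En en binn exp1n.
  have -> : (n %/ s %| k) = false.
    apply/negP => ek; move: en; rewrite {2}En -addn1 dvdn_addr // dvdn1.
    by rewrite (gtn_eqF e1).
  by rewrite exp0n // muln0.
pose free := [set w in sum_model | #|porbit rotpair_perm w| == n].
have cM : #|sum_model| = n.+1 * #|X|.
  apply/eqP; rewrite -(eqn_pmul2l n_gt0); apply/eqP.
  have := card_sum_model_fixed (dvdnn n); rewrite rotpair_full divnn n_gt0.
  rewrite (_ : [set w in sum_model | _] = sum_model); last first.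
    by apply/setP=> w; rewrite inE perm1 eqxx andbT.
  rewrite /sparse_bin !dvd1n !divn1 => ->; rewrite mulnCA EX -!mulnn.
  have Ek : (n - k) * 'C(n, k) = k.+1 * 'C(n, k.+1).
    by rewrite -mul_bin_down mul_bin_diag.
  transitivity ((n - k) * 'C(n, k) * 'C(n, k) + k.+1 * 'C(n, k.+1) * 'C(n, k.+1)); first by ring.
  transitivity (k.+1 * 'C(n, k.+1) * 'C(n, k) + (n - k) * 'C(n, k) * 'C(n, k.+1)).
    by rewrite Ek.
  have -> : n.+1 = k.+1 + (n - k) by rewrite addSn subnKC // ltnW.
  by ring.
have le_free : n * #|X| <= #|free|.
  have := sum_model_nonfree_le lt_k1n EX.
  have := cardsID [set w | #|porbit rotpair_perm w| == n] sum_model.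
  rewrite (_ : sum_model :&: _ = free); last by apply/setP=> w; rewrite !inE.
  rewrite (_ : sum_model :\: _ = [set w in sum_model | #|porbit rotpair_perm w| != n]); last first.
    by apply/setP=> w; rewrite !inE andbC.
  rewrite cM mulSn => E le_nf.
  rewrite -(leq_add2r #|[set w in sum_model | #|porbit rotpair_perm w| != n]|) E.
  by rewrite addnC leq_add2r.
have [K [subK stK nfK cK]] := remove_free_orbits n_gt0 sum_model_stable le_free.
have {}cK : #|X| = #|K| by move: cK; rewrite cM mulSn => /addIn.
pose beta (x : X) : {set 'I_n} * {set 'I_n} := enum_val (cast_ord cK (enum_rank x)).
have beta_inj : injective beta by move=> x y /enum_val_inj /cast_ord_inj /enum_rank_inj.
have codomE w : (w \in codom beta) = (w \in K).
  apply/codomP/idP => [[x ->] | wK]; first exact: enum_valP.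
  exists (enum_val (cast_ord (esym cK) (enum_rank_in wK w))).
  by rewrite /beta enum_valK cast_ordKV enum_rankK_in.
have stable x : rotpair_perm (beta x) \in codom beta.
  by rewrite codomE stK -codomE codom_f.
have [P [PE fixE]] := perm_of_stable (@perm_inj _ rotpair_perm) beta_inj stable.
exists P; split=> [|s sn lt_sn].
  by apply/permP => x; apply: beta_inj; rewrite PE -permX rotpair_full !perm1.
rewrite -(card_sum_model_fixed sn) fixE; congr (_ * _); apply: eq_card => w.
rewrite !inE codomE -permX; case fw : (_ == w); rewrite ?andbF // !andbT.
apply/idP/idP => [/(subsetP subK) | wM]; first by rewrite inE.
apply: nfK; first by rewrite inE.
apply/eqP => cw; have := free_expg_neq n_gt0 cw (s := s).
by rewrite (dvdn_gt0 n_gt0 sn) lt_sn fw => /(_ isT).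
Qed.

End SumModel.

(** * Cyclic sieving for two-column rectangles *)

(** The value at q = 1 of [qNarayana_det]. *)
Lemma card_tableaux_det m k : 0 < k ->
  #|SSYT (nseq k 2) m| + 'C(m, k.+1) * 'C(m, k.-1) = 'C(m, k) ^ 2.
Proof.
by move=> k_gt0; have := card_ballot_set m k; rewrite card_tableaux //; case: k k_gt0.
Qed.

Lemma card_tableaux_Narayana m k : 0 < k -> k <= m ->
  m.+1 * #|SSYT (nseq k 2) m| = 'C(m.+1, k) * 'C(m.+1, k.+1).
Proof.
move=> k_gt0 le_km; have := card_tableaux_det m k_gt0; set N := #|_|.
have E1 : m.+1 * 'C(m, k) = k.+1 * 'C(m.+1, k.+1) by rewrite -mul_bin_diag.
have E2 : m.+1 * 'C(m, k) = (m.+1 - k) * 'C(m.+1, k) by rewrite -mul_bin_down.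
have E3 : m.+1 * 'C(m, k.-1) = k * 'C(m.+1, k).
  by have := mul_bin_diag m.+1 k.-1; rewrite prednK.
have E4 : m.+1 * 'C(m, k.+1) = (m - k) * 'C(m.+1, k.+1).
  by rewrite -subSS -mul_bin_down.
move=> EN; apply/eqP; rewrite -(@eqn_pmul2l m.+1) //; apply/eqP.
apply: (@addIn (m.+1 * 'C(m, k.+1) * (m.+1 * 'C(m, k.-1)))).
transitivity (m.+1 * m.+1 * (N + 'C(m, k.+1) * 'C(m, k.-1))); first by ring.
rewrite EN -mulnn; transitivity (m.+1 * 'C(m, k) * (m.+1 * 'C(m, k))); first by ring.
rewrite {1}E1 E2 E3 E4.
have -> : m.+1 - k = (m - k).+1 by rewrite subSn.
have Em : m.+1 = m - k + k.+1 by rewrite addnS subnK.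
by move: 'C(_, _) 'C(_, _) => x z; rewrite {1}Em; ring.
Qed.

Lemma evq_card_tableaux (C : numClosedFieldType) (w : C) m k : 0 < k ->
  (1.-primitive_root w)%R -> evq w (qNarayana m.+1 k.+1) = #|SSYT (nseq k 2) m|%:R%R.
Proof.
move=> k_gt0 w1; apply: (addIr (('C(m, k.+1) * 'C(m, k.-1))%:R)%R).
by rewrite (evq_qNarayana1 w1) // -natrD card_tableaux_det.
Qed.

Theorem theorem54 (C : numClosedFieldType) (n k : nat)
    (hk : (1 <= k)%N) (hkn : (k < n)%N) :
  (exists (gT : finGroupType) (g : gT)
          (to : action <[g]>%g (SSYT (nseq k 2%N) n.-1)),
     [/\ #[g]%g = n.-1,
         forall T b, entry (to T g) b = promotion n.-1 (entry T) b
       & cyclic_sieving C to (qNarayana n k.+1)])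
  /\
  (exists (gT : finGroupType) (phi : gT)
          (to : action <[phi]>%g (SSYT (nseq k 2%N) n.-1)),
     #[phi]%g = n /\ cyclic_sieving C to (qNarayana n k.+1)).
Proof.
case: n hkn => [|[|n]] hkn; [by [] | by case: k hk hkn => [|[]] |].
rewrite [n.+2.-1]/=; have nonneg := @qNarayana_nonneg n.+1 k hk; split.
  have [P [P_order P_prom P_fix]] := promotion_perm n hk.
  have [|gT [g [to [og toE cs]]]] := cyclic_sieving_of_perm (C := C) (ltn0Sn n) P_order nonneg.
    move=> s sn w w_prim; rewrite P_fix.
    have s_gt0 : 0 < s := dvdn_gt0 (ltn0Sn n) sn.
    have [lt_sn | le_ns] := ltnP s n.+1; last first.
      have Es : s = n.+1 by apply/eqP; rewrite eqn_leq le_ns dvdn_leq.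
      rewrite Es divnn in w_prim; rewrite evq_card_tableaux //.
      rewrite card_tableaux // -card_match_set; congr (_%:R)%R; apply: eq_card => x.
      by rewrite inE Es iter_rotmatch_full eqxx andbT.
    have e1 : 1 < n.+1 %/ s by rewrite ltn_divRL // mul1n.
    have s2 : s + s <= n.+1.
      by rewrite addnn -mul2n -(divnK sn) leq_mul2r e1 orbT.
    rewrite card_fixed_short // card_periodic_words //.
    by rewrite (evq_qNarayana_pred w_prim) ?dvdn_div.
  by exists gT, g, to; split=> // T b; rewrite toE P_prom.
have cX := card_tableaux_Narayana hk (hkn : k <= n.+1).
have [|P [P_order P_fix]] := @order_n_perm n.+2 k hk hkn (SSYT (nseq k 2) n.+1).
  by rewrite -cX.
have [|gT [g [to [og _ cs]]]] := cyclic_sieving_of_perm (C := C) (ltn0Sn n.+1) P_order nonneg.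
  move=> s sn w w_prim.
  have s_gt0 : 0 < s := dvdn_gt0 (ltn0Sn n.+1) sn.
  have [lt_sn | le_ns] := ltnP s n.+2; last first.
    have Es : s = n.+2 by apply/eqP; rewrite eqn_leq le_ns dvdn_leq.
    rewrite Es divnn in w_prim; rewrite evq_card_tableaux //.
    rewrite -cardsT; congr (_%:R)%R; apply: eq_card => T.
    by rewrite !inE Es P_order perm1 eqxx.
  have e1 : 1 < n.+2 %/ s by rewrite ltn_divRL // mul1n.
  have n0 : (n.+2%:R != 0 :> C)%R by rewrite Num.Theory.pnatr_eq0.
  apply: (mulIf n0); rewrite (evq_qNarayana_full w_prim) ?dvdn_div // -natrM mulnC.
  by rewrite P_fix.
by exists gT, g, to.
Qed.
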